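(* Fix integers $K\ge 2$, a real number $\theta\in(0,1)$, and a probability vector $\underline{p}=(p_1,\dots,p_K)$ with $p_k>0$ for all $k$. Let $D_K^{*}(\theta,\underline{p})=\lim_{n\to\infty}D^n_*(\theta,\underline{p})$ be the limiting minimum expected $\mathbb{L}_1$-distortion of a $\theta$-DP histogram sanitizing mechanism (defined in the context). Then: (a) The limit exists and $$D_K^{*}(\theta,\underline{p})=\frac{2\theta}{\mathrm{Ehr}_{\mathcal{P}}(\theta)}\,\frac{d\,\mathrm{Ehr}_{\mathcal{P}}(\theta)}{d\theta}-\frac{2\theta}{1-\theta},\qquad \mathrm{Ehr}_{\mathcal{P}}(z):=1+\sum_{d=1}^{\infty}L_{\mathcal{P}}(d)z^{d},$$ where $L_{\mathcal{P}}(d)$ is the number of points with integer coordinates in the polytope $$\mathcal{P}_d=\Big\{(x_1,\dots,x_K)\in\mathbb{R}^K:\ \sum_{k=1}^K x_k=0,\ \sum_{k=1}^K|x_k|\le 2d\Big\}.$$ In particular $D_K^{*}(\theta,\underline{p})$ does not depend on $\underline{p}$. (b) $$\mathrm{Ehr}_{\mathcal{P}}(\theta)=\frac{1}{1-\theta}+\sum_{d=1}^{\infty}\Big\{\sum_{r=1}^{K-1}\binom{K}{r}\binom{d+r-1}{r-1}\binom{d-1}{K-r-1}\Big\}\frac{\theta^{d}}{1-\theta}.$$ (c) $$D_K^{*}(\theta,\underline{p})=2\theta\Big\{\frac{K-1}{1-\theta}+\frac{S_{K-1}'(\theta)}{S_{K-1}(\theta)}\Big\},\qquad S_{K-1}(\theta)=\sum_{j=0}^{K-1}\theta^{j}\binom{K-1}{j}^{2},$$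 with $S'_{K-1}$ the derivative of $S_{K-1}$. Moreover, $D_K^*(\theta,\underline p)$ is attained in the limit by truncations of the geometric mechanism: letting $\mathcal{H}^n_{\mathrm{ext}}=\{\underline{h}\in\mathbb{Z}^K:\sum_k h_k=n\}$ and $\mathbb{U}(\underline{g}|\underline{h})=\big((1-\theta)\mathrm{Ehr}_{\mathcal{P}}(\theta)\big)^{-1}\theta^{|\underline{g}-\underline{h}|_1/2}$ for $\underline{h}\in\mathcal{H}^n$, $\underline{g}\in\mathcal{H}^n_{\mathrm{ext}}$, there exist deterministic maps $f_n:\mathcal{H}^n_{\mathrm{ext}}\to\mathcal{H}^n$ such that the mechanisms $\mathbb{W}^n(\underline{g}|\underline{h})=\sum_{\underline{b}\in\mathcal{H}^n_{\mathrm{ext}}:\,f_n(\underline{b})=\underline{g}}\mathbb{U}(\underline{b}|\underline{h})$ are $\theta$-DP HSMs with $\lim_{n\to\infty}D^n(\mathbb{W}^n,\underline{p})=D_K^*(\theta,\underline{p})$.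
   Context: For $n\in\mathbb{N}$ let $\mathcal{H}^n=\{(h_1,\dots,h_K)\in\mathbb{Z}^K: h_k\ge 0,\ \sum_k h_k=n\}$ (histograms of databases of $n$ records over a set of $K$ possible records). Two histograms $\underline{h},\underline{\hat h}\in\mathcal{H}^n$ are neighboring if $|\underline{h}-\underline{\hat h}|_1=2$. A histogram sanitizing mechanism (HSM) is a conditional pmf $\mathbb{W}(\cdot|\underline{h})$ on $\mathcal{H}^n$ for each $\underline{h}\in\mathcal{H}^n$; it is $\theta$-DP if $\theta\,\mathbb{W}(\underline{g}|\underline{h})\le \mathbb{W}(\underline{g}|\underline{\hat h})\le\theta^{-1}\mathbb{W}(\underline{g}|\underline{h})$ for all neighboring $\underline{h},\underline{\hat h}$ and all $\underline{g}$. Its expected $\mathbb{L}_1$-distortion is $D^n(\mathbb{W},\underline{p})=\sum_{\underline{h},\underline{g}\in\mathcal{H}^n}\binom{n}{h_1,\dots,h_K}\prod_k p_k^{h_k}\,\mathbb{W}(\underline{g}|\underline{h})\,|\underline{h}-\underline{g}|_1$, and $D^n_*(\theta,\underline{p})$ is the minimum of $D^n(\mathbb{W},\underline{p})$ over all $\theta$-DP HSMs. $D_K^*(\theta,\underline p)=\lim_{n\to\infty}D^n_*(\theta,\underline p)$. *)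

(* Defs.v *)
From HB Require Import structures.
From mathcomp Require Import all_boot all_order all_algebra.
From mathcomp Require Import all_classical all_reals all_analysis.
Set Implicit Arguments. Unset Strict Implicit. Unset Printing Implicit Defensive.
Import Order.TTheory GRing.Theory Num.Theory.
Import numFieldNormedType.Exports.
Local Open Scope classical_set_scope.
Local Open Scope ring_scope.

Definition hist (K n : nat) := {ffun 'I_K -> 'I_n.+1}.

Definition Hn (K n : nat) : {set hist K n} :=
  [set h : hist K n | (\sum_(k < K) (h k : nat))%N == n].

Definition hz (K n : nat) (h : hist K n) : 'I_K -> int := fun k => (h k : nat)%:Z.

Definition l1z (K : nat) (x y : 'I_K -> int) : nat := (\sum_(k < K) `|x k - y k|)%N.

Definition neighbor (K n : nat) (h h' : hist K n) : Prop := l1z (hz h) (hz h') = 2%N.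

(* A mechanism W g h stands for W(g | h). *)
Definition mech (R : realType) (K n : nat) := hist K n -> hist K n -> R.

Definition isHSM (R : realType) (K n : nat) (W : mech R K n) : Prop :=
  forall h, h \in Hn K n ->
    (forall g, g \in Hn K n -> 0 <= W g h) /\ \sum_(g in Hn K n) W g h = 1.

Definition isDP (R : realType) (K n : nat) (theta : R) (W : mech R K n) : Prop :=
  forall h h' g, h \in Hn K n -> h' \in Hn K n -> g \in Hn K n -> neighbor h h' ->
    theta * W g h <= W g h' /\ W g h' <= theta^-1 * W g h.

Definition multinom (R : realType) (K n : nat) (h : hist K n) : R :=
  (n`!)%:R / \prod_(k < K) ((h k : nat)`!)%:R.

Definition Dn (R : realType) (K n : nat) (W : mech R K n) (p : 'I_K -> R) : R :=
  \sum_(h in Hn K n) \sum_(g in Hn K n)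
     multinom R h * (\prod_(k < K) p k ^+ (h k : nat)) * W g h * (l1z (hz h) (hz g))%:R.

(* D^n_*(theta, p): minimum (infimum, which is attained) over theta-DP HSMs *)
Definition Dnstar (R : realType) (K n : nat) (theta : R) (p : 'I_K -> R) : R :=
  inf [set x : R | exists W : mech R K n, [/\ isHSM W, isDP theta W & x = Dn W p]].

(* L_P(d): number of integer points x in Z^K with sum x = 0 and |x|_1 <= 2d.
   Such points satisfy |x_k| <= 2d, so they are encoded as y in {0..4d}^K with
   x_k = y_k - 2d. *)
Definition LP (K d : nat) : nat :=
  #|[set y : {ffun 'I_K -> 'I_(4 * d).+1} |
      ((\sum_(k < K) ((y k : nat)%:Z - (2 * d)%:Z)) == 0)%R &&
      ((\sum_(k < K) `|(y k : nat)%:Z - (2 * d)%:Z|)%N <= 2 * d)%N]|.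

Definition Ehr (R : realType) (K : nat) (z : R) : R :=
  1 + limn (fun N => \sum_(1 <= d < N) ((LP K d)%:R * z ^+ d)).

Definition Spoly (R : realType) (K : nat) : {poly R} :=
  \sum_(j < K) (('C(K.-1, j) ^ 2)%:R *: 'X^j).

(* integer vectors (elements of H^n_ext when their sum is n) *)
Definition zvec (K : nat) := {ffun 'I_K -> int}.
Definition zsum (K : nat) (b : zvec K) : int := \sum_(k < K) b k.

(* geometric mechanism U(b | h), b in H^n_ext, h in H^n.
   |b - h|_1 is even since both sum to n, so ./2 is exact division. *)
Definition Ugeo (R : realType) (K n : nat) (theta : R) (b : zvec K) (h : hist K n) : R :=
  ((1 - theta) * Ehr K theta)^-1 * theta ^+ (l1z (fun k => b k) (hz h))./2.

Definition Wtrunc (R : realType) (K n : nat) (theta : R)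
    (f : zvec K -> hist K n) : mech R K n :=
  fun g h => fine (\esum_(b in [set b : zvec K | zsum b = n%:Z /\ f b = g])
                     (Ugeo theta b h)%:E).
Arguments Dnstar {R} K n theta p.

(* Main.v *)
Require Import Defs.
From HB Require Import structures.
From mathcomp Require Import all_boot all_order all_algebra.
From mathcomp Require Import all_classical all_reals all_analysis.
From mathcomp Require Import zify ring lra.
Import Order.TTheory GRing.Theory Num.Theory.
Import numFieldNormedType.Exports.
Set Implicit Arguments.
Unset Strict Implicit.
Unset Printing Implicit Defensive.

(** Fix an output [g]. Up to the slowly varying multinomial weight, the column
    [h |-> W(g | h)] of a [theta]-DP mechanism is [theta ^ d(g, h)] times a
    function [w] that increases along geodesics leaving [g], where [d] is half
    the l1-distance. The lower bound says that such a [w] is positively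
    correlated with [d] under the weights [theta ^ d]. These weights are a
    mixture over [s], with weights proportional to ['C(s + K - 1, K - 1) ^ 2 *
    theta ^ s], of the laws of the difference of two independent uniform
    compositions of [s] into [K] parts; an explicit nonnegative flow along
    outward edges carries the [s]-th law to the next one, so the mean of [w] is
    nondecreasing in [s], and Chebyshev's sum inequality concludes. Shrinking
    [theta] slightly absorbs the multinomial ratio of neighboring histograms in
    the bulk. The same flow applied to [w = 1] and [w = -1] yields the generating
    function of the shell sizes. For the upper bound, the geometric mechanism is
    rounded to a nearest histogram: this at most doubles the distortion, and does
    not change it unless the noise reaches the boundary of the simplex. *)

(** * Binomial identities *)

(** Pairs of compositions enter because [w] is known to grow only along outward edges, and the urn
    step on pairs carries uniform laws to uniform laws. If [X - Y = h - g] and [h] is at distance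
    [d], then [X] and [Y] are the positive and negative parts of [h - g] plus a common composition
    of [s - d]. In the full mixture with parameter [t] the size of that common part is independent
    of [h] and negative binomial, with mean [K t / (1 - t)]. So the mean of [s] given [h] is
    [d + K t / (1 - t)], and correlation of [w] with [s] becomes correlation with [d]. Near the
    boundary of the simplex neither the flow nor the multinomial ratios are under control. The
    argument is therefore confined to a ball of fixed radius [S] around [g], and the mixture is cut
    at [S]; the terms cut off have a favourable sign. Outputs [g] far from the mean are given up, at
    a cost of at most [S] times the probability of an atypical input. The parameter [t < theta] and
    the radius [S] are fixed before [n], so the threshold on [n] is uniform in the mechanism. *)

Lemma trinomial_revision n m l : l <= m ->
  'C(n, m) * 'C(m, l) = 'C(n, l) * 'C(n - l, m - l).
Proof.
move=> lm; have [mn|nm] := leqP m n; last first.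
  rewrite bin_small // mul0n; have [nl|ln] := ltnP n l; first by rewrite bin_small.
  by rewrite [in RHS](@bin_small (n - l)) ?muln0 //; lia.
apply/eqP; rewrite -(eqn_pmul2r (fact_gt0 l)) -(eqn_pmul2r (fact_gt0 (m - l))).
rewrite -(eqn_pmul2r (fact_gt0 (n - m))); apply/eqP.
have E1 := bin_fact lm; have E2 := bin_fact mn.
have E3 := bin_fact (leq_trans lm mn).
have E4 : 'C(n - l, m - l) * ((m - l)`! * (n - m)`!) = (n - l)`!.
  by rewrite -(bin_fact (leq_sub2r l mn)) (_ : n - l - (m - l) = n - m) //; lia.
transitivity n`!.
  rewrite -E2 -[X in _ = _ * (X * _)]E1; ring.
rewrite -E3 -E4; ring.
Qed.

(** Coefficient form of [sum_s 'C(s + k, k) ^ 2 x ^ s = S_k(x) / (1 - x) ^ (2 k + 1)]. Vandermonde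
    is used to expand twice, trinomial revision separates the indices, and a last Vandermonde sums
    over [i]. *)
Lemma sq_bin_sum k s :
  'C(s + k, k) ^ 2 = \sum_(j < k.+1) 'C(k, j) ^ 2 * 'C(s + k.*2 - j, k.*2).
Proof.
have vdm i : 'C(i + k, i) = \sum_(j < k.+1) 'C(k, j) * 'C(i, j).
  rewrite addnC -(bin_sub (leq_addl _ _)) addnK -binomial.Vandermonde.
  rewrite (reindex_inj rev_ord_inj) /=; apply: eq_bigr => j _.
  rewrite subSS bin_sub -1?ltnS //; congr (_ * 'C(_, _)).
  by have := ltn_ord j; lia.
have -> : 'C(s + k, k) ^ 2 =
    \sum_(i < k.+1) 'C(k, i) * ('C(s + k, k + i) * 'C(i + k, i)).
  rewrite -mulnn {1}(_ : 'C(s + k, k) = 'C(s + k, s)); last first.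
    by rewrite -(bin_sub (leq_addl _ _)) addnK.
  rewrite vdm big_distrl /=; apply: eq_bigr => i _.
  rewrite -mulnA; congr (_ * _).
  rewrite (_ : 'C(i + k, i) = 'C(k + i, k)); last first.
    by rewrite -(bin_sub (leq_addr _ _)) addKn addnC.
  by rewrite trinomial_revision ?leq_addr // !addnK addKn mulnC.
under eq_bigr => i _ do rewrite vdm 2!big_distrr /=.
rewrite exchange_big /=; apply: eq_bigr => j _.
have jk : j <= k by rewrite -ltnS.
transitivity (\sum_(i < k.+1) 'C(k, j) ^ 2 * ('C(k - j, k - i) * 'C(s + k, k + i))).
  apply: eq_bigr => i _; have ik : i <= k by rewrite -ltnS.
  have -> : 'C(k, j) ^ 2 * ('C(k - j, k - i) * 'C(s + k, k + i)) =
     'C(k, j) * ('C(k, j) * 'C(k - j, k - i)) * 'C(s + k, k + i) by ring.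
  have -> : 'C(k, j) * 'C(k - j, k - i) = 'C(k, i) * 'C(i, j); last by ring.
  have [ji|ij] := leqP j i; last first.
    by rewrite (@bin_small (k - j)) ?(@bin_small i) ?muln0 //; lia.
  rewrite trinomial_revision // -(@bin_sub (k - j) (i - j)); last by lia.
  by congr (_ * 'C(_, _)); lia.
rewrite -big_distrr /=; congr (_ * _).
rewrite (_ : s + k.*2 - j = (k - j) + (s + k)); last by rewrite -addnn; lia.
rewrite -binomial.Vandermonde (reindex_inj rev_ord_inj) /=.
rewrite -(big_mkord xpredT (fun q => 'C(k - j, k - (k.+1 - q.+1)) * 'C(s + k, k + (k.+1 - q.+1)))).
rewrite -(big_mkord xpredT (fun q => 'C(k - j, q) * 'C(s + k, k.*2 - q))).
rewrite [RHS](big_cat_nat (n := k.+1)) /=; try by rewrite -?addnn; lia.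
rewrite [X in _ = _ + X]big_nat_cond [X in _ = _ + X]big1 ?addn0; last first.
  by move=> q /andP[/andP[kq _] _]; rewrite bin_small //; lia.
rewrite big_nat_cond [RHS]big_nat_cond; apply: eq_bigr => q /andP[/andP[_ qk] _].
by congr ('C(_, _) * 'C(_, _)); rewrite -?addnn; lia.
Qed.

(** Coefficients of the product of [(1 - x) ^ -(a + 1)] and [(1 - x) ^ -(b + 1)]; Pascal's rule
    drives a double induction on [a] and [m]. *)
Lemma negbin_conv a b m :
  \sum_(i < m.+1) 'C(i + a, a) * 'C(m - i + b, b) = 'C(m + a + b + 1, a + b + 1).
Proof.
elim: a m => [|a IHa] m.
  rewrite addn0 add0n; elim: m => [|m IHm].
    by rewrite big_ord1 !add0n !bin0 binn addn1 binn.
  rewrite big_ord_recl /= addn0 bin0 mul1n subn0.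
  rewrite (_ : m.+1 + b + 1 = (m + b + 1).+1); last by lia.
  have -> : 'C((m + b + 1).+1, b + 1) = 'C(m + b + 1, b + 1) + 'C(m + b + 1, b).
    by rewrite [b + 1]addn1 binS.
  rewrite -IHm addnC; congr (_ + _).
    by apply: eq_bigr => i _; rewrite !bin0 /bump /= add1n subSS.
  by congr 'C(_, _); lia.
elim: m => [|m IHm].
  by rewrite big_ord1 !add0n !binn.
rewrite (_ : m.+1 + a.+1 + b + 1 = (m.+1 + a + b + 1).+1); last by lia.
rewrite (_ : a.+1 + b + 1 = (a + b + 1).+1); last by lia.
rewrite binS -IHa.
rewrite (_ : 'C(_, (a + b + 1).+1) = 'C(m + a.+1 + b + 1, a.+1 + b + 1)); last first.
  by congr 'C(_, _); lia.
rewrite -IHm [X in _ = X + _](_ : _ = \sum_(i < m.+2) 'C(i + a, a.+1) * 'C(m.+1 - i + b, b)).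
  rewrite -big_split /=; apply: eq_bigr => i _.
  by rewrite addnS binS mulnDl.
rewrite [RHS]big_ord_recl /= bin_small // mul0n add0n.
by apply: eq_bigr => i _; rewrite /bump /= add1n addSnnS subSS.
Qed.

Lemma mul_bin_succ s k : s.+1 * 'C(s.+1 + k, k) = (s + k.+1) * 'C(s + k, k).
Proof.
have := mul_bin_down (s + k).+1 k; rewrite /= addSn addnS => ->.
by congr (_ * _); lia.
Qed.

(* The coefficients of [S_k(x) / (1 - x) ^ (a + 1)]; the choices [a = k - 1],
   [a = k] and [a = 2 k] give the shell sizes, [LP] and ['C(d + k, k) ^ 2]. *)
Definition sqbin_coef k a d : nat :=
  \sum_(j < k.+1) if j <= d then 'C(k, j) ^ 2 * 'C(d - j + a, a) else 0.

Lemma sqbin_coef_double k s : sqbin_coef k k.*2 s = ('C(s + k, k) ^ 2)%N.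
Proof.
rewrite sq_bin_sum; apply: eq_bigr => j _; case: leqP => js.
  by congr (_ * 'C(_, _))%N; lia.
by rewrite (@bin_small (_ - _)) ?muln0 //; have := ltn_ord j; lia.
Qed.

(** Multiplying the series by [(1 - x) ^ -(b + 1)] adds [b + 1] to the exponent; [b = 0] is the
    passage to partial sums. *)
Lemma sqbin_coef_conv k a b s :
  (\sum_(d < s.+1) sqbin_coef k a d * 'C(s - d + b, b) = sqbin_coef k (a + b + 1) s)%N.
Proof.
rewrite /sqbin_coef; under eq_bigr => d _ do rewrite big_distrl /=.
rewrite exchange_big /=; apply: eq_bigr => j _.
rewrite -(big_mkord xpredT (fun d => (if j <= d then 'C(k, j) ^ 2 * 'C(d - j + a, a) else 0)
  * 'C(s - d + b, b))%N).
case: leqP => js; last first.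
  rewrite big_nat_cond big1 // => d /andP[/andP[_ ds] _].
  by rewrite leqNgt (leq_trans ds js).
rewrite (big_cat_nat (n := j)) //=; last by rewrite leqW.
rewrite big_nat_cond big1 ?add0n => [|d /andP[/andP[_ dj] _]]; last by rewrite leqNgt dj.
rewrite -[X in (\sum_(X <= _ < _) _)%N]add0n big_addn subSn // big_mkord.
rewrite !addnA -negbin_conv big_distrr /=; apply: eq_bigr => d _.
by rewrite leq_addl addnK -mulnA; congr (_ * (_ * 'C(_, _)))%N; lia.
Qed.

Local Open Scope ring_scope.

(** * Radial flows on histograms *)

Section Transfer.
Context {K B : nat}.
Implicit Types (g h : hist K B) (k l : 'I_K).

(** Truncated subtraction keeps the positive part of [h - g]. On balanced pairs the positive and
    negative parts have equal mass, so this is half the l1-distance. *)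
Definition excess h g : nat := (\sum_(k < K) (h k - g k))%N.

Definition balanced g h := excess h g == excess g h.

(** One record moves from bin [l] to bin [k]. The value is the intended one when [h k < B] and
    [0 < h l]; otherwise [inord] or the predecessor of 0 distorts it. *)
Definition transfer k l h : hist K B :=
  [ffun i => inord (if i == k then (h i).+1
                    else if i == l then (h i).-1 else h i)].

(** Both changed coordinates of [transfer k l h] move away from [g]. [inward] is the same condition
    read at the far end of the edge, whence its strict inequalities; the edge is then undone by
    [transfer l k]. *)
Definition outward g h k l :=
  [&& k != l, (g k <= h k)%N & (h l <= g l)%N].

Definition inward g h k l :=
  [&& k != l, (g k < h k)%N & (h l < g l)%N].

Lemma transferE k l h i : k != l -> (h k < B)%N ->
  transfer k l h i = (if i == k then (h i).+1
                    else if i == l then (h i).-1 else h i) :> nat.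
Proof.
move=> kl hk; rewrite ffunE inordK //.
case: eqP => [->//|_]; case: eqP => _ //.
by rewrite (leq_ltn_trans (leq_pred _)).
Qed.

Lemma transfer1 k l h : k != l -> (h k < B)%N -> transfer k l h k = (h k).+1 :> nat.
Proof. by move=> kl hk; rewrite transferE // eqxx. Qed.

Lemma transfer2 k l h : k != l -> (h k < B)%N -> transfer k l h l = (h l).-1 :> nat.
Proof. by move=> kl hk; rewrite transferE // eqxx eq_sym (negPf kl). Qed.

Lemma transfer3 k l h i : k != l -> (h k < B)%N -> i != k -> i != l ->
  transfer k l h i = h i :> nat.
Proof. by move=> kl hk ik il; rewrite transferE // (negPf ik) (negPf il). Qed.

Lemma transferK k l h : k != l -> (h k < B)%N -> (0 < h l)%N ->
  transfer l k (transfer k l h) = h.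
Proof.
move=> kl hk hl; apply/ffunP => i; apply: val_inj => /=.
have hl' : (transfer k l h l < B)%N.
  by rewrite transfer2 // prednK // -ltnS.
rewrite transferE 1?eq_sym //; case: (eqVneq i l) => [->|il].
  by rewrite transfer2 // prednK.
case: (eqVneq i k) => [->|ik]; first by rewrite transfer1.
by rewrite transfer3.
Qed.

(** Written additively to avoid truncated subtraction. Coordinate [l] is separate because a transfer
    does change it, although its summand stays the same for another reason. *)
Lemma eq_sum_transfer (F G : 'I_K -> nat) k l : k != l ->
  (forall i, i != k -> i != l -> F i = G i) -> F l = G l ->
  (\sum_i F i + G k = \sum_i G i + F k)%N.
Proof.
move=> kl FG Fl; rewrite (bigD1 (F := F) k) //= (bigD1 (F := G) k) //=.
rewrite (eq_bigr G); first by move: (bigop _ _ _) => S; lia.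
by move=> i ik; case: (eqVneq i l) => [->//|]; apply: FG.
Qed.

Lemma excess_le g h k : (h k - g k <= excess h g)%N.
Proof. by rewrite /excess (bigD1 k) //= leq_addr. Qed.

Lemma excess_transfer k l g h : outward g h k l -> (h k < B)%N ->
  excess (transfer k l h) g = (excess h g).+1.
Proof.
move=> /and3P[kl gk hl] hk.
have : (excess (transfer k l h) g + (h k - g k)
        = excess h g + (transfer k l h k - g k))%N.
  apply: (@eq_sum_transfer (fun i => transfer k l h i - g i)%N
            (fun i => h i - g i)%N k l kl) => [i ik il|].
    by rewrite transfer3.
  by rewrite transfer2 //; lia.
by rewrite transfer1 //; lia.
Qed.

Lemma excess_transferC k l g h : outward g h k l -> (h k < B)%N -> (0 < h l)%N ->
  excess g (transfer k l h) = (excess g h).+1.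
Proof.
move=> /and3P[kl gk hl] hk hl0.
have lk : l != k by rewrite eq_sym.
have : (excess g (transfer k l h) + (g l - h l)
        = excess g h + (g l - transfer k l h l))%N.
  apply: (@eq_sum_transfer (fun i => g i - transfer k l h i)%N
            (fun i => g i - h i)%N l k lk) => [i il ik|].
    by rewrite transfer3.
  by rewrite transfer1 //; lia.
by rewrite transfer2 //; lia.
Qed.

Lemma inward_transfer k l g h : outward g h k l -> (h k < B)%N -> (0 < h l)%N ->
  inward g (transfer k l h) k l.
Proof.
move=> /and3P[kl gk hl] hk hl0.
by rewrite /inward kl transfer1 // transfer2 // ltnS gk /=; lia.
Qed.

Lemma inward_bounds k l g h : inward g h k l -> [/\ l != k, (h l < B)%N & (0 < h k)%N].
Proof.
move=> /and3P[kl gk hl]; split; first by rewrite eq_sym.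
  by rewrite (leq_trans hl) // -ltnS.
by apply: leq_trans gk.
Qed.

Lemma outward_transfer k l g h : inward g h k l -> outward g (transfer l k h) k l.
Proof.
move=> H; have [lk hlB hk0] := inward_bounds H.
move: H => /and3P[kl gk hl].
by rewrite /outward kl transfer1 // transfer2 // hl andbT /=; lia.
Qed.

Lemma inwardE k l g h : inward g h k l ->
  excess h g = (excess (transfer l k h) g).+1 /\
  excess g h = (excess g (transfer l k h)).+1.
Proof.
move=> H; have [lk hlB hk0] := inward_bounds H.
have O := outward_transfer H; have hk := ltn_ord (h k).
have kl : k != l by rewrite eq_sym.
have ha : (transfer l k h k < B)%N by rewrite transfer2 //; lia.
have hb : (0 < transfer l k h l)%N by rewrite transfer1.
by have := excess_transferC O ha hb; have := excess_transfer O ha; rewrite transferK.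
Qed.

End Transfer.

(** * The urn flow from the ball of radius [s] to the ball of radius [s + 1] *)

Section Flow.
Variables (R : realFieldType) (k B s : nat).
Local Notation K := k.+1.
Variable g : hist K B.
(** The margin exceeds [s], so that no outward move from the ball of radius [s] is blocked by the
    walls of the box. *)
Hypothesis gs : forall i, (s < g i)%N /\ (g i + s < B)%N.
Implicit Types (h : hist K B) (a b : 'I_K).

Let d h : nat := excess h g.
Let u h a : R := (h a - g a)%N%:R.
Let v h a : R := (g a - h a)%N%:R.
Let p h a : nat := (g a < h a)%N.
Let n h a : nat := (h a < g a)%N.
Let ip h : nat := (\sum_a p h a)%N.
Let jn h : nat := (\sum_a n h a)%N.
(** [c0 m] counts the compositions [Z] of [m] into [K] parts. By symmetry [c1 m] is the sum of
    [Z_a + 1] over all of them, the total urn weight of a fixed bin [a]; this is [c1E] below. *)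
Let c0 m : R := 'C(m + k, k)%:R.
Let c1 m : R := 'C(m + K, K)%:R.

(* The mass carried along the edge from [h] to [transfer a b h]. It comes from
   the Polya urn step [(X, Y) -> (X + e_a, Y + e_b)] on pairs of compositions
   with [X - Y = h - g]: opposite moves are cancelled, and a move that keeps the
   distance to [g] is rerouted through an outward and an inward edge, with
   probability proportional to the coordinate of the opposite sign it uses. *)
Let F h a b : R :=
  c0 (s - d h) * u h a * v h b
  + c1 (s - d h) * (1 + (u h a * v h b * (ip h + jn h)%N%:R
      + v h b * ((ip h)%:R - (p h a)%:R) + u h a * ((jn h)%:R - (n h b)%:R)) / (d h)%:R).

Let ip_ge h a : (p h a <= ip h)%N.
Proof. by rewrite /ip (bigD1 a) //= leq_addr. Qed.

Let jn_ge h a : (n h a <= jn h)%N.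
Proof. by rewrite /jn (bigD1 a) //= leq_addr. Qed.

Let F_ge0 h a b : 0 <= F h a b.
Proof.
by rewrite /F /c0 /c1 /u /v -!natrB ?ip_ge ?jn_ge.
Qed.

Let bounds h a b : balanced g h -> (d h <= s)%N -> outward g h a b ->
  (h a < B)%N /\ (0 < h b)%N.
Proof.
move=> /eqP bal dh /and3P[ab ga hb].
have := excess_le h g b; have := excess_le g h a.
have := gs a; have := gs b; move: dh; rewrite /d bal; lia.
Qed.

Let sum_mul (x y : 'I_K -> R) : \sum_a \sum_b x a * y b = (\sum_a x a) * (\sum_b y b).
Proof. by rewrite mulr_suml; apply: eq_bigr => a _; rewrite mulr_sumr. Qed.

Let sum_u h : \sum_a u h a = (d h)%:R.
Proof. by rewrite /u -natr_sum. Qed.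

Let sum_v h : balanced g h -> \sum_a v h a = (d h)%:R.
Proof. by move=> /eqP; rewrite /v -natr_sum /d => ->. Qed.

Let sum_p h : \sum_a (p h a)%:R = (ip h)%:R :> R.
Proof. by rewrite -natr_sum. Qed.

Let sum_n h : \sum_a (n h a)%:R = (jn h)%:R :> R.
Proof. by rewrite -natr_sum. Qed.

(** Settles the degenerate case of the quotient by [d h] in [F], where the inverse of 0 is 0. *)
Let d0_ip h : balanced g h -> d h = 0%N -> ip h = 0%N /\ jn h = 0%N.
Proof.
move=> /eqP bal d0; split; apply: big1 => a _.
  by have := excess_le g h a; rewrite -/(d h) d0 /p; lia.
by have := excess_le h g a; rewrite -bal -/(d h) d0 /n; lia.
Qed.

(** Plays the same part for [inflow], where the quotient is by the predecessor's distance
    [d h - 1]. *)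
Let d1_ip h : balanced g h -> d h = 1%N -> ip h = 1%N /\ jn h = 1%N.
Proof.
move=> /eqP bal d1.
have P (x : 'I_K -> nat) : (\sum_a x a = 1)%N -> (\sum_a (0 < x a : bool) = 1)%N.
  move=> x1; rewrite -[RHS]x1; apply: eq_bigr => a _.
  by have : (x a <= 1)%N; [rewrite -x1 (bigD1 a) //= leq_addr | case: (x a) => [|[]]].
split.
  by rewrite -(P _ d1); apply: eq_bigr => a _; rewrite subn_gt0.
by move: d1; rewrite /d bal => d1; rewrite -(P _ d1); apply: eq_bigr => a _; rewrite subn_gt0.
Qed.

Let outflow h : balanced g h ->
  \sum_a \sum_(b | outward g h a b) F h a b =
  c0 (s - d h) * (d h)%:R ^+ 2
  + c1 (s - d h) * (K%:R ^+ 2 - K%:R - (ip h)%:R * (jn h)%:R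
                    + (d h)%:R * ((ip h)%:R + (jn h)%:R)).
Proof.
move=> bal; set c := c0 _; set c' := c1 _; set i := (ip h)%:R; set j := (jn h)%:R.
(* [P] and [Q] are the indicators of [g a <= h a] and [h a <= g a]. The sum over all pairs then
   factors, and the diagonal, which lives where [h a = g a], is subtracted. *)
pose P a : R := 1 - (n h a)%:R; pose Q a : R := 1 - (p h a)%:R.
have sP : \sum_a P a = K%:R - j.
  by rewrite sumrB sum_n sumr_const card_ord.
have sQ : \sum_a Q a = K%:R - i.
  by rewrite sumrB sum_p sumr_const card_ord.
have Pu a : P a * u h a = u h a.
  rewrite /P /u /n; case: ltnP => // ha; last by rewrite subr0 mul1r.
  by rewrite (eqP (ltnW ha : (_ - _ == 0)%N)) mulr0.
have Qv a : Q a * v h a = v h a.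
  rewrite /Q /v /p; case: ltnP => // ha; last by rewrite subr0 mul1r.
  by rewrite (eqP (ltnW ha : (_ - _ == 0)%N)) mulr0.
have Pp a : P a * (i - (p h a)%:R) = i * P a - (p h a)%:R.
  by rewrite /P /n /p; case: ltngtP => //= _; ring.
have Qn a : Q a * (j - (n h a)%:R) = j * Q a - (n h a)%:R.
  by rewrite /Q /n /p; case: ltngtP => //= _; ring.
have -> : \sum_a \sum_(b | outward g h a b) F h a b =
   \sum_a \sum_b P a * Q b * F h a b - \sum_a P a * Q a * F h a a.
  rewrite -sumrB; apply: eq_bigr => a _.
  rewrite (bigD1 a (P := xpredT)) //= addrAC subrr add0r [LHS]big_mkcond [RHS]big_mkcond /=.
  apply: eq_bigr => b _; rewrite /outward eq_sym.
  case: eqP => //= _; rewrite /P /Q /n /p.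
  by case: ltnP => //= ha; case: ltnP => //= hb; ring.
have -> : \sum_a P a * Q a * F h a a = c' * (K%:R - i - j).
  have -> : K%:R - i - j = \sum_a P a * Q a.
    transitivity (\sum_a (1 - (p h a)%:R - (n h a)%:R : R)).
      by rewrite !sumrB sum_p sum_n sumr_const card_ord.
    by apply: eq_bigr => a _; rewrite /P /Q /n /p; case: ltngtP => //= _; ring.
  rewrite mulr_sumr; apply: eq_bigr => a _.
  rewrite /F /P /Q /u /v -/c -/c' /n /p.
  case: ltngtP => /= [_|_|->]; rewrite ?subrr ?mul0r ?mulr0 ?mul0r ?mulr0 //.
  by rewrite subnn !(mul0r, mulr0, addr0, add0r); ring.
have -> : \sum_a \sum_b P a * Q b * F h a b =
   \sum_a \sum_b u h a * (c * v h b) + \sum_a \sum_b P a * (c' * Q b)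
   + ((i + j) * \sum_a \sum_b u h a * (c' / (d h)%:R * v h b)
      + \sum_a \sum_b (i * P a - (p h a)%:R) * (c' / (d h)%:R * v h b)
      + \sum_a \sum_b u h a * (c' / (d h)%:R * (j * Q b - (n h b)%:R))).
  rewrite mulr_sumr -!big_split /=; apply: eq_bigr => a _.
  rewrite mulr_sumr -!big_split /=; apply: eq_bigr => b _.
  rewrite -Pp -Qn -[in RHS]Pu -[in RHS]Qv /F -/c -/c' natrD -/i -/j; ring.
rewrite !sum_mul -!mulr_sumr sP sQ !sumrB -!mulr_sumr sum_u sum_v // sP sQ sum_p sum_n -/i -/j.
case: (eqVneq (d h) 0%N) => [d0|d0]; last first.
  by field; rewrite pnatr_eq0.
have [i0 j0] := d0_ip bal d0.
by rewrite /i /j i0 j0 d0 invr0; ring.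
Qed.

Let inflow h : balanced g h -> (0 < d h)%N ->
  \sum_a \sum_(b | inward g h a b) F (transfer b a h) a b =
  c0 (s.+1 - d h) * ((d h)%:R ^+ 2 - (d h)%:R * ((ip h)%:R + (jn h)%:R) + (ip h)%:R * (jn h)%:R)
  + c1 (s.+1 - d h) * ((d h)%:R * ((ip h)%:R + (jn h)%:R) - (ip h)%:R * (jn h)%:R).
Proof.
move=> bal dpos; set c := c0 _; set c' := c1 _; set i := (ip h)%:R; set j := (jn h)%:R.
(* [D] is the distance of the predecessor from [g]; [u'] and [v'] are its parts at the two changed
   coordinates, set to 0 where no inward edge exists. *)
pose D : R := (d h)%:R - 1.
pose u' a : R := (p h a)%:R * (u h a - 1); pose v' a : R := (n h a)%:R * (v h a - 1).
have su' : \sum_a u' a = (d h)%:R - i.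
  rewrite -sum_u /i -sum_p -sumrB; apply: eq_bigr => a _.
  rewrite /u' /u /p; case: ltnP => ha /=; first by ring.
  by rewrite (eqP (ha : (_ - _ == 0)%N)) /=; ring.
have sv' : \sum_a v' a = (d h)%:R - j.
  rewrite -sum_v // /j -sum_n -sumrB; apply: eq_bigr => a _.
  rewrite /v' /v /n; case: ltnP => ha /=; first by ring.
  by rewrite (eqP (ha : (_ - _ == 0)%N)) /=; ring.
have -> : \sum_a \sum_(b | inward g h a b) F (transfer b a h) a b =
  \sum_a \sum_b u' a * (c * v' b) + \sum_a \sum_b (p h a)%:R * (c' * (n h b)%:R)
  + (\sum_a \sum_b u' a * (c' / D * (i + j) * v' b)
     + \sum_a \sum_b (p h a)%:R * (c' / D * (i - 1) * v' b)
     + \sum_a \sum_b u' a * (c' / D * (j - 1) * (n h b)%:R)).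
  rewrite -!big_split /=; apply: eq_bigr => a _.
  rewrite -!big_split /= big_mkcond /=; apply: eq_bigr => b _.
  have [H|H] := boolP (inward g h a b); last first.
    rewrite /u' /v' /p /n; move: H; rewrite /inward.
    case: ltnP => ha; last by move=> _ /=; ring.
    case: ltnP => hb; last by move=> _ /=; ring.
    by rewrite andbT andbT negbK => /eqP ab; move: ha hb; rewrite ab; lia.
  have [E1 E2] := inwardE H; have [ba hbB ha0] := inward_bounds H.
  have ab : a != b by rewrite eq_sym.
  case/and3P: (H) => _ ga hb.
  have pa : p h a = 1%N by rewrite /p ga.
  have nb : n h b = 1%N by rewrite /n hb.
  have Ed : (d (transfer b a h))%:R = D by rewrite /D /d E1 -natr1 addrK.
  have Es : (s - d (transfer b a h) = s.+1 - d h)%N by rewrite /d E1; lia.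
  have Eu : u (transfer b a h) a = u h a - 1.
    by rewrite /u transfer2 // -[1]/(1%:R) -natrB ?subn_gt0 //; congr _%:R; lia.
  have Ev : v (transfer b a h) b = v h b - 1.
    by rewrite /v transfer1 // -[1]/(1%:R) -natrB ?subn_gt0 //; congr _%:R; lia.
  have Ei : (ip (transfer b a h) + 1 = ip h + p (transfer b a h) a)%N.
    rewrite -pa; apply: (@eq_sum_transfer _ _ (p _) _ b) => //.
      by move=> x xa xb; rewrite /p transfer3.
    by rewrite /p transfer1 // ltnNge hb ltnNge (ltnW hb).
  have Ej : (jn (transfer b a h) + 1 = jn h + n (transfer b a h) b)%N.
    rewrite -nb; apply: (@eq_sum_transfer _ _ (n _) _ a) => //.
      by move=> x xa xb; rewrite /n transfer3.
    by rewrite /n transfer2 // !ltnNge -ltnS prednK // ga (ltnW ga).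
  have Ei' : (ip (transfer b a h))%:R - (p (transfer b a h) a)%:R = i - 1 :> R.
    by have := congr1 (fun x => x%:R : R) Ei; rewrite !natrD -/i; lra.
  have Ej' : (jn (transfer b a h))%:R - (n (transfer b a h) b)%:R = j - 1 :> R.
    by have := congr1 (fun x => x%:R : R) Ej; rewrite !natrD -/j; lra.
  (* A count of the predecessor differs from that of [h] exactly when the matching factor
     [u h a - 1] or [v h b - 1] is 0, so the product does not see the change. *)
  have Eij : (u h a - 1) * (v h b - 1) * (ip (transfer b a h) + jn (transfer b a h))%N%:R
     = (u h a - 1) * (v h b - 1) * (i + j).
    have Hu : (u h a - 1) * (1 - (p (transfer b a h) a)%:R) = 0.
      rewrite -Eu /u /p; case: ltnP => hh; first by rewrite subrr mulr0.
      by rewrite (eqP (hh : (_ - _ == 0)%N)) mul0r.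
    have Hv : (v h b - 1) * (1 - (n (transfer b a h) b)%:R) = 0.
      rewrite -Ev /v /n; case: ltnP => hh; first by rewrite subrr mulr0.
      by rewrite (eqP (hh : (_ - _ == 0)%N)) mul0r.
    have -> : (ip (transfer b a h) + jn (transfer b a h))%N%:R
      = i + j - (1 - (p (transfer b a h) a)%:R) - (1 - (n (transfer b a h) b)%:R) :> R.
      rewrite natrD -[(ip _)%:R](subrK (p (transfer b a h) a)%:R) Ei'.
      rewrite -[(jn _)%:R](subrK (n (transfer b a h) b)%:R) Ej'; ring.
    set x := u h a - 1 in Hu *; set y := v h b - 1 in Hv *.
    set al := 1 - _ in Hu *; set be := 1 - _ in Hv *.
    transitivity (x * y * (i + j) - y * (x * al) - x * (y * be)); first by ring.
    by rewrite Hu Hv !mulr0 !subr0.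
  rewrite /F Eu Ev Es Ed -/c -/c' Eij Ei' Ej' /u' /v' pa nb; ring.
rewrite !sum_mul -!mulr_sumr su' sv' sum_p sum_n -/i -/j.
case: (eqVneq (d h) 1%N) => [d1|d1]; last first.
  have D0 : D != 0 by rewrite /D subr_eq0 (eqr_nat R (d h) 1).
  have -> : (d h)%:R = D + 1 by rewrite /D subrK.
  by field.
have [i1 j1] := d1_ip bal d1.
by rewrite /D /i /j i1 j1 d1; ring.
Qed.

(** Every outward edge leaving the ball of radius [s] is an inward edge at a point of the ball of
    radius [s + 1], and conversely; [transfer a b] and [transfer b a] exchange its ends. *)
Let inflow_sum (w : hist K B -> R) :
  \sum_(h | balanced g h && (d h <= s)%N) \sum_a \sum_(b | outward g h a b)
     F h a b * w (transfer a b h) =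
  \sum_(h | balanced g h && (d h <= s.+1)%N)
     w h * \sum_a \sum_(b | inward g h a b) F (transfer b a h) a b.
Proof.
under [RHS]eq_bigr => h _ do
  (rewrite mulr_sumr; under eq_bigr => a _ do rewrite mulr_sumr).
rewrite exchange_big [RHS]exchange_big /=; apply: eq_bigr => a _.
rewrite (exchange_big_dep xpredT) //= [RHS](exchange_big_dep xpredT) //=.
apply: eq_bigr => b _.
rewrite (reindex_onto (transfer b a) (transfer a b)) /=; last first.
  move=> h /andP[/andP[bal dh] O]; case/and3P: (O) => ab _ _.
  by have [ha hb] := bounds bal dh O; rewrite transferK.
apply: eq_big => [h|h /andP[_ /eqP->]]; last by rewrite mulrC.
apply/idP/idP.
  move=> /andP[/andP[/andP[bal dh] O] /eqP E].
  have [ha hb] := bounds bal dh O; have {}bal : excess _ _ = _ := eqP bal.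
  have := inward_transfer O ha hb; rewrite E => I.
  have [E1 E2] := inwardE I.
  by rewrite I /balanced /d E1 E2 -bal eqxx ltnS dh.
move=> /andP[/andP[/eqP bal dh] I].
have [E1 E2] := inwardE I; have [ba hbB ha0] := inward_bounds I.
rewrite outward_transfer // transferK // eqxx !andbT /balanced.
by move: bal dh; rewrite /d E1 E2 ltnS => -[->] ->; rewrite eqxx.
Qed.

Let c0S m : (m.+1)%:R * c0 m.+1 = (m + K)%N%:R * c0 m.
Proof. by rewrite /c0 -!natrM mul_bin_succ. Qed.

Let c1E m : K%:R * c1 m = (m + K)%N%:R * c0 m.
Proof. by rewrite /c0 /c1 -!natrM -mul_bin_diag addnS. Qed.

Let c1S m : c1 m.+1 = c1 m + c0 m.+1.
Proof. by rewrite /c1 /c0 -natrD addSn binS addnS addSn. Qed.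

(** [F] has the divergence of the urn step. A composition of [s] emits total weight [s + K] and one
    of [s + 1] receives total weight [s + 1]; both are squared for pairs and multiplied by the
    number of pairs with difference [h - g]. The support counts [ip h] and [jn h] cancel between
    inflow and outflow. *)
Let net_flow h : balanced g h -> (d h <= s.+1)%N ->
  \sum_a \sum_(b | inward g h a b) F (transfer b a h) a b
  - (if (d h <= s)%N then \sum_a \sum_(b | outward g h a b) F h a b else 0)
  = (s.+1)%:R ^+ 2 * c0 (s.+1 - d h)
  - (if (d h <= s)%N then (s + K)%N%:R ^+ 2 * c0 (s - d h) else 0).
Proof.
move=> bal dh; set I := \sum_a _.
have -> : I = c0 (s.+1 - d h)
    * ((d h)%:R ^+ 2 - (d h)%:R * ((ip h)%:R + (jn h)%:R) + (ip h)%:R * (jn h)%:R)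
  + c1 (s.+1 - d h) * ((d h)%:R * ((ip h)%:R + (jn h)%:R) - (ip h)%:R * (jn h)%:R).
  rewrite /I; case: (posnP (d h)) => [d0|]; last exact: inflow.
  have [i0 j0] := d0_ip bal d0; rewrite d0 i0 j0.
  rewrite big1 => [|a _]; first by ring.
  rewrite big1 // => b /inwardE[E _].
  by move: d0; rewrite /d E.
have c10 : c1 0 = 1 by rewrite /c1 add0n binn.
have c00 : c0 0 = 1 by rewrite /c0 add0n binn.
move: dh; rewrite leq_eqVlt => /orP[/eqP dh|].
  by rewrite dh ltnn subnn c00 c10 !subr0; ring.
rewrite ltnS => dh; rewrite dh outflow // subSn //.
have -> : (s.+1)%:R = (s - d h).+1%:R + (d h)%:R :> R.
  by rewrite -natrD addSn subnK.
have -> : (s + K)%N%:R = (s - d h + K)%N%:R + (d h)%:R :> R.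
  by rewrite -natrD addnAC subnK.
set m := (s - d h)%N; have E1 := c0S m; have E2 := c1E m.
rewrite c1S; set x := c0 m in E1 E2 *; set x' := c0 _ in E1 *; set y := c1 m in E2 *.
rewrite natrD in E1 E2 *; rewrite -natr1 in E1 *.
set M : R := m%:R in E1 E2 *; set D : R := (d h)%:R.
apply/eqP; rewrite -subr_eq0; apply/eqP.
(* The difference is a combination of the relations [E1] and [E2], with these multipliers. *)
transitivity (((M + K%:R) * x - (M + 1) * x') * (M + 1 + 2 * D)
  + (K%:R - 1) * ((M + K%:R) * x - K%:R * y)); first by ring.
by rewrite E1 E2 !subrr mul0r mulr0 addr0.
Qed.

(* ['C(s - d + k, k)] is the number of pairs of weak compositions of [s] into
   [K] parts whose difference is a given vector of l1-norm [2 * d]. *)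
Lemma mean_flow_le (w : hist K B -> R) :
  (forall h a b, balanced g h -> (excess h g <= s)%N -> outward g h a b ->
     w h <= w (transfer a b h)) ->
  (s + K)%N%:R ^+ 2 * (\sum_(h | balanced g h && (excess h g <= s)%N)
     'C(s - excess h g + k, k)%:R * w h)
  <= s.+1%:R ^+ 2 * (\sum_(h | balanced g h && (excess h g <= s.+1)%N)
     'C(s.+1 - excess h g + k, k)%:R * w h).
Proof.
move=> wmono; rewrite -subr_ge0.
have -> : s.+1%:R ^+ 2 * (\sum_(h | balanced g h && (excess h g <= s.+1)%N)
     'C(s.+1 - excess h g + k, k)%:R * w h)
   - (s + K)%N%:R ^+ 2 * (\sum_(h | balanced g h && (excess h g <= s)%N)
     'C(s - excess h g + k, k)%:R * w h)
  = \sum_(h | balanced g h && (d h <= s)%N) \sum_a \sum_(b | outward g h a b)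
     F h a b * (w (transfer a b h) - w h).
  transitivity (\sum_(h | balanced g h && (d h <= s)%N) \sum_a
       \sum_(b | outward g h a b) F h a b * w (transfer a b h)
     - \sum_(h | balanced g h && (d h <= s)%N) \sum_a
       \sum_(b | outward g h a b) F h a b * w h); last first.
    rewrite -sumrB; apply: eq_bigr => h _; rewrite -sumrB; apply: eq_bigr => a _.
    by rewrite -sumrB; apply: eq_bigr => b _; rewrite mulrBr.
  rewrite inflow_sum.
  have widen (f : hist K B -> R) : \sum_(h | balanced g h && (d h <= s)%N) f h =
    \sum_(h | balanced g h && (d h <= s.+1)%N) if (d h <= s)%N then f h else 0.
    rewrite -big_mkcondr /=; apply: eq_bigl => h.
    by case: balanced => //=; case: (leqP (d h) s) => [/leqW->|]; rewrite ?andbF.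
  rewrite -/d !widen !mulr_sumr -!sumrB; apply: eq_bigr => h /andP[bal dh].
  have -> : \sum_a \sum_(b | outward g h a b) F h a b * w h
      = (\sum_a \sum_(b | outward g h a b) F h a b) * w h.
    by rewrite mulr_suml; apply: eq_bigr => a _; rewrite mulr_suml.
  have := net_flow bal dh; rewrite /c0 /d; case: ifP => _.
    by move=> E; rewrite !mulrA -mulrBl -E mulrBl; congr (_ - _); rewrite mulrC.
  by rewrite !mulr0 !subr0 => E; rewrite mulrA -E mulrC.
apply: sumr_ge0 => h /andP[bal dh]; apply: sumr_ge0 => a _; apply: sumr_ge0 => b O.
by rewrite mulr_ge0 // subr_ge0 wmono.
Qed.

End Flow.

(** * Shell sizes *)

Lemma excess_int K B (y g : hist K B) :
  (\sum_x ((y x)%:Z - (g x)%:Z) = (excess y g)%:Z - (excess g y)%:Z) /\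
  (\sum_x `|(y x)%:Z - (g x)%:Z| = excess y g + excess g y)%N.
Proof.
have P (a b : nat) : a%:Z - b%:Z = (a - b)%N%:Z - (b - a)%N%:Z by lia.
split; last by rewrite /excess -big_split; apply: eq_bigr => x _ /=; lia.
by rewrite /excess !(big_morph Posz PoszD (erefl _)) -sumrB; apply: eq_bigr => x _; exact: P.
Qed.

Definition weak_compositions (r i : nat) : nat :=
  if r is r'.+1 then 'C(i + r', r') else (i == 0%N).

(** Below degree [N] the truncated polynomial has the same powers as the series [1 / (1 - x)]. *)
Lemma geometric_poly_exp_coef (T : comNzRingType) N r i : (i < N)%N ->
  ((\poly_(a < N) (1 : T)) ^+ r)`_i = (weak_compositions r i)%:R.
Proof.
elim: r i => [|r IHr] i iN.
  by rewrite expr0 coef1.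
rewrite exprS coefM.
have -> : weak_compositions r.+1 i = (\sum_(j < i.+1) weak_compositions r j)%N.
  case: r {IHr} => [|r] /=.
    by rewrite bin0 big_ord_recl /= big1.
  have := negbin_conv r 0 i; rewrite !addn0 !addn1 -addnS => <-.
  by apply: eq_bigr => j _; rewrite addn0 bin0 muln1.
rewrite (reindex_inj rev_ord_inj) /= natr_sum; apply: eq_bigr => j _.
have ji := ltn_ord j; rewrite subSS coef_poly ifT; last by lia.
by rewrite mul1r IHr; [congr (weak_compositions r _)%:R | ]; lia.
Qed.

(* Integer points of l1-norm [2 * d] with coordinate sum [0], sorted by their
   number [r] of nonnegative coordinates. *)
Definition shell_size (K d : nat) : nat :=
  if d is 0%N then 1%N else (\sum_(1 <= r < K)
    'C(K, r) * 'C(d + r - 1, r - 1) * 'C(d - 1, K - r - 1))%N.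

Lemma excess_sum_eq0 K B (g h : hist K B) : excess h g = 0%N -> excess g h = 0%N -> h = g.
Proof.
move=> h0 g0; apply/ffunP => x; apply: val_inj => /=.
by have := excess_le h g x; have := excess_le g h x; rewrite h0 g0; lia.
Qed.

(** The count is the coefficient of [x ^ d y ^ d] in a [K]-th power: a coordinate contributes
    [x ^ i] if it exceeds [g] by [i >= 0], and [y ^ i] if it falls short by [i >= 1]. The binomial
    expansion sorts by the number of nonnegative coordinates. The margin [d] keeps the whole shell
    inside the box. *)
Lemma card_shell K B (g : hist K B) d :
  (forall x, (d <= g x)%N /\ (g x + d <= B)%N) ->
  #|[set h : hist K B | (excess h g == d) && (excess g h == d)]| = shell_size K d.
Proof.
case: d => [_|d' gd].
  transitivity #|[set g]|; last by rewrite cards1.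
  apply: eq_card => h; rewrite !inE.
  apply/andP/eqP => [[/eqP h0 /eqP g0]|->]; first exact: excess_sum_eq0.
  by rewrite /excess big1 // => x _; rewrite subnn.
set d := d'.+1 in gd *.
have d0 : (0 < d)%N by [].
(* The outer variable records the positive part, the inner one the negative part. *)
pose A : {poly {poly int}} := \poly_(a < d.+1) 1.
pose C : {poly int} := 'X * \poly_(a < d) 1.
pose F x (j : 'I_B.+1) : {poly {poly int}} := 'X^(j - g x) * ('X^(g x - j))%:P.
(* Restricting to offsets at most [d] makes every coordinate contribute the same polynomial [A + C],
   whatever [g x] is. *)
pose Q x : pred 'I_B.+1 := fun j => (g x <= j + d)%N && (j <= g x + d)%N.
have FQ x : \sum_(j | Q x j) F x j = A + C%:P.
  have [dg gB] := gd x.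
  rewrite -(big_mkord (fun j => (g x <= j + d)%N && (j <= g x + d)%N)
    (fun j => 'X^(j - g x) * ('X^(g x - j))%:P)).
  rewrite (big_cat_nat (n := (g x - d)%N)) //=; last by lia.
  rewrite big_nat_cond big1 ?add0r => [|i /andP[/andP[_ id] /andP[di _]]]; last by lia.
  rewrite (big_cat_nat (n := g x)) //=; [|by lia..].
  rewrite (big_cat_nat (n := (g x + d).+1) (m := g x)) //=; [|by lia..].
  rewrite [X in _ + (_ + X)]big_nat_cond [X in _ + (_ + X)]big1 ?addr0; last first.
    by move=> i /andP[/andP[id _] /andP[_ di]]; lia.
  rewrite addrC; congr (_ + _).
    rewrite /A poly_def -[X in \sum_(X <= _ < _ | _) _]add0n big_addn.
    rewrite (_ : (_ - _ = d.+1)%N); last by lia.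
    rewrite -(big_mkord xpredT (fun i => 1 *: 'X^i)) big_nat_cond [RHS]big_nat_cond.
    apply: eq_big => i; first by lia.
    move=> _; rewrite addnK scale1r (_ : (g x - _ = 0)%N); last by lia.
    by rewrite expr0 mulr1.
  rewrite /C poly_def mulr_sumr rmorph_sum /= big_nat_rev /=.
  rewrite -[X in \sum_(X <= _ < _ | _) _]add0n big_addn.
  rewrite (_ : (g x - (g x - d) = d)%N); last by lia.
  rewrite -(big_mkord xpredT (fun i => ('X * (1 *: 'X^i))%:P)) big_nat_cond [RHS]big_nat_cond.
  apply: eq_big => i; first by lia.
  move=> /andP[/andP[_ id] _]; rewrite scale1r -exprS.
  rewrite (_ : (_ - g x = 0)%N); last by lia.
  by rewrite expr0 mul1r; congr ('X^_)%:P; lia.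
have prodF (h : hist K B) : \prod_x F x (h x) = 'X^(excess h g) * ('X^(excess g h))%:P.
  by rewrite /F big_split /= -!prodrXr -rmorph_prod.
have coefAC r m : (A ^+ r * C%:P ^+ m)`_d`_d =
  (weak_compositions r d * (if m is m'.+1 then 'C(d', m') else 0))%N%:R.
  rewrite -polyC_exp coefMC geometric_poly_exp_coef // mulr_natl coefMn natrM mulr_natl.
  congr (_ *+ _); case: m => [|m]; first by rewrite expr0 coef1.
  rewrite exprMn coefXnM; case: ltnP => dm.
    by rewrite bin_small.
  rewrite geometric_poly_exp_coef /=; last by lia.
  by congr ('C(_, _))%:R; lia.
have : (#|[set h : hist K B | (excess h g == d) && (excess g h == d)]|)%:R
   = ((A + C%:P) ^+ K)`_d`_d :> int.
  rewrite -[in RHS](card_ord K) -prodr_const.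
  under [in RHS]eq_bigr => x _ do rewrite -(FQ x).
  rewrite bigA_distr_big_dep /= !coef_sum -sum1_card natr_sum.
  rewrite big_mkcond [in RHS]big_mkcond /=; apply: eq_bigr => h _.
  rewrite prodF coefMC coefXn inE.
  case: (eqVneq (excess h g) d) => [hd|_] /=; last by rewrite mul0r coef0 if_same.
  rewrite mul1r coefXn [d == _]eq_sym.
  case: (eqVneq (excess g h) d) => [gh|_]; last by rewrite if_same.
  rewrite ifT //; apply/familyP => x; rewrite /in_mem /= /Q.
  by have := excess_le g h x; have := excess_le h g x; rewrite hd gh; lia.
move=> E; apply/eqP; rewrite -(eqr_nat int) E exprDn !coef_sum; apply/eqP.
transitivity ((\sum_(0 <= r < K.+1) 'C(K, r) * (weak_compositions r d *
    (if (K - r)%N is m'.+1 then 'C(d', m') else 0)))%N%:R : int).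
  rewrite big_mkord natr_sum (reindex_inj rev_ord_inj) /=; apply: eq_bigr => r _.
  by rewrite !coefMn subSS subKn -1?ltnS // coefAC -mulrnA mulnC bin_sub // -ltnS.
(* As [d > 0], both positive and negative coordinates occur, so the terms [r = 0] and [r = K]
   vanish. *)
congr _%:R; rewrite /shell_size {2}/d big_ltn // mul0n muln0 add0n.
case: (posnP K) => [->|K0]; first by rewrite !big_geq.
rewrite big_nat_recr //= subnn !muln0 addn0 big_nat_cond [RHS]big_nat_cond.
apply: eq_bigr => r /andP[/andP[r1 rK] _]; rewrite -mulnA; congr (_ * _)%N.
case: r r1 rK => // r _ rK /=; congr ('C(_, _) * _)%N; try lia.
have -> : (K - r.+1 = (K - r.+1 - 1).+1)%N by lia.
by congr 'C(_, _); lia.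
Qed.

Lemma sum_by_shell K B (g : hist K B) s (f : nat -> nat) :
  (forall x, (s <= g x)%N /\ (g x + s <= B)%N) ->
  (\sum_(h | balanced g h && (excess h g <= s)) f (excess h g)
   = \sum_(d < s.+1) shell_size K d * f d)%N.
Proof.
move=> gs; rewrite (partition_big (fun h => inord (excess h g) : 'I_s.+1) xpredT) //=.
apply: eq_bigr => d _; have ds := ltn_ord d.
rewrite -(@card_shell _ _ g d); last by move=> x; have := gs x; lia.
rewrite -sum_nat_const; apply: eq_big => h; last first.
  by move=> /andP[/andP[_ hs] /eqP <-]; rewrite inordK.
rewrite inE /balanced; apply/andP/andP => [[/andP[/eqP bal hs] /eqP <-]|[/eqP hd /eqP gd]].
  by rewrite inordK // -bal.
by rewrite hd gd eqxx -ltnS ds; split => //; apply/eqP/val_inj; rewrite /= inordK.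
Qed.

(** Both sides count pairs of compositions of [s] into [k + 1] parts, the left one by their
    difference. For constant [w] the flow inequality holds with both signs, hence is an equality:
    the recursion satisfied by ['C(r + k, k) ^ 2]. *)
Lemma sum_shell_conv k s :
  (\sum_(d < s.+1) shell_size k.+1 d * 'C(s - d + k, k) = 'C(s + k, k) ^ 2)%N.
Proof.
pose g : hist k.+1 s.*2 := [ffun => inord s].
have gE x : g x = s :> nat by rewrite ffunE inordK //; lia.
pose V (w : rat) r := \sum_(h | balanced g h && (excess h g <= r)%N)
   'C(r - excess h g + k, k)%:R * w.
have VE r : (r <= s)%N -> V 1 r = (\sum_(d < r.+1) shell_size k.+1 d * 'C(r - d + k, k))%N%:R.
  move=> rs; rewrite -(@sum_by_shell _ _ g r (fun d => 'C(r - d + k, k))); last first.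
    by move=> x; rewrite gE; lia.
  by rewrite natr_sum; apply: eq_bigr => h _; rewrite mulr1.
have VN r : V (-1) r = - V 1 r.
  by rewrite /V -sumrN; apply: eq_bigr => h _; rewrite mulrN.
suff H r : (r <= s)%N -> V 1 r = ('C(r + k, k) ^ 2)%N%:R.
  by apply/eqP; rewrite -(eqr_nat rat) -VE // H.
elim: r => [|r IHr] rs.
  by rewrite VE // big_ord1 /= binn.
have gr x : (r < g x)%N /\ (g x + r < s.*2)%N by rewrite gE; lia.
have mono (w : rat) : (r + k.+1)%N%:R ^+ 2 * V w r <= r.+1%:R ^+ 2 * V w r.+1.
  exact: (@mean_flow_le rat k _ r g gr (fun=> w)).
have E : r.+1%:R ^+ 2 * V 1 r.+1 = (r + k.+1)%N%:R ^+ 2 * V 1 r.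
  by apply/eqP; rewrite eq_le mono andbT; have := mono (-1); rewrite !VN; lra.
apply: (@mulfI _ (r.+1%:R ^+ 2)); first by rewrite expf_neq0 // pnatr_eq0.
by rewrite E IHr ?(ltnW rs) // -!natrX -!natrM -!expnMn mul_bin_succ.
Qed.

(** Both sequences have the same convolution with ['C(i + k, k)], whose term at [i = 0] is 1; strong
    induction therefore deconvolves. *)
Lemma shell_sizeE k d : (0 < k)%N -> shell_size k.+1 d = sqbin_coef k k.-1 d.
Proof.
move=> k0; elim/ltn_ind: d => s IHs.
have := sum_shell_conv k s.
rewrite -sqbin_coef_double (_ : k.*2 = (k.-1 + k + 1)%N); last by lia.
rewrite -sqbin_coef_conv !big_ord_recr /= subnn binn !muln1.
rewrite (eq_bigr (fun d : 'I_s => sqbin_coef k k.-1 d * 'C(s - d + k, k))%N).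
  by move/addnI.
by move=> d _; rewrite IHs.
Qed.

Lemma LP_shell K d : LP K d = (\sum_(e < d.+1) shell_size K e)%N.
Proof.
pose g : hist K (4 * d) := [ffun => inord (2 * d)].
have gE x : g x = (2 * d)%N :> nat by rewrite ffunE inordK //; lia.
have := @sum_by_shell K _ g d (fun=> 1%N).
rewrite sum1_card => E; under eq_bigr do rewrite -[shell_size _ _]muln1.
rewrite -E; last by move=> x; rewrite gE; lia.
rewrite /LP; apply: eq_card => y; rewrite [RHS]unfold_in.
transitivity ((\sum_(x < K) ((y x : nat)%:Z - (2 * d)%N%:Z) == 0) &&
    (\sum_(x < K) `|(y x : nat)%:Z - (2 * d)%N%:Z|%N <= 2 * d)%N).
  by apply/idP/idP => [/set_mem|/mem_set].
have [E1 E2] := excess_int y g.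
have -> : \sum_x ((y x)%:Z - (2 * d)%N%:Z) = (excess y g)%:Z - (excess g y)%:Z.
  by rewrite -E1; apply: eq_bigr => x _; rewrite gE.
have -> : (\sum_x `|(y x)%:Z - (2 * d)%N%:Z| = excess y g + excess g y)%N.
  by rewrite -E2; apply: eq_bigr => x _; rewrite gE.
rewrite /balanced; move: (excess y g) (excess g y) => a b.
by rewrite subr_eq0 eqz_nat; case: eqP => //= ->; lia.
Qed.

Lemma LPE k d : (0 < k)%N -> LP k.+1 d = sqbin_coef k k d.
Proof.
move=> k0; rewrite LP_shell -[in RHS](prednK k0).
have := sqbin_coef_conv k k.-1 0 d; rewrite addn0 addn1 prednK // => <-.
by apply: eq_bigr => e _; rewrite shell_sizeE // bin0 muln1.
Qed.

Local Open Scope classical_set_scope.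
Local Open Scope ring_scope.

(** * Generating functions *)

Lemma cvg_sum_ord (R : realType) (m : nat) (u : 'I_m -> R ^nat) (l : 'I_m -> R) :
  (forall i, u i n @[n --> \oo] --> l i) ->
  \sum_(i < m) u i n @[n --> \oo] --> \sum_(i < m) l i.
Proof. by move=> ul; apply: cvg_big => //; apply: add_continuous. Qed.

Lemma cvg_series_shift (R : realType) (v : R ^nat) (j : nat) (l : R) :
  series v n @[n --> \oo] --> l ->
  series (fun d => if (j <= d)%N then v (d - j)%N else 0) n @[n --> \oo] --> l.
Proof.
move=> vl; rewrite -(cvg_shiftn j); apply: cvg_trans vl.
apply: near_eq_cvg; near=> n; rewrite /series /= addnC.
rewrite [RHS](big_cat_nat (n := j)) //= ?leq_addr //.
rewrite [X in _ = X + _]big_nat_cond [X in _ = X + _]big1 ?add0r; last first.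
  by move=> i /andP[/andP[_ ij] _]; rewrite leqNgt ij.
rewrite -{1}[j]add0n big_addn addKn; apply: eq_bigr => i _.
by rewrite leq_addl addnK.
Unshelve. all: by end_near. Qed.

Section NegBinomialSeries.
Variables (R : realType) (x : R).
Hypothesis x01 : 0 <= x < 1.

Let x0 : 0 <= x. Proof. by case/andP: x01. Qed.
Let x1 : 0 < 1 - x. Proof. by rewrite subr_gt0; case/andP: x01. Qed.

Definition negbin a m : R := 'C(m + a, a)%:R * x ^+ m.

Lemma negbin_ge0 a m : 0 <= negbin a m.
Proof. by rewrite /negbin mulr_ge0 // exprn_ge0. Qed.

(** Multiplication by [1 - x] telescopes the partial sums for [a + 1] into those for [a], up to a
    boundary term. Monotonicity and this bound first give convergence, which in turn forces the
    boundary term to 0. *)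
Lemma negbin_cvg a : series (negbin a) n @[n --> \oo] --> ((1 - x) ^+ a.+1)^-1.
Proof.
elim: a => [|a IHa].
  have -> : negbin 0 = geometric 1 x.
    by apply/funext => m; rewrite /negbin /geometric /= bin0.
  rewrite expr1 -[_^-1]mul1r; apply: cvg_geometric_series.
  by rewrite ger0_norm //; case/andP: x01.
have tele n : (1 - x) * series (negbin a.+1) n
              = series (negbin a) n - 'C(n + a, a.+1)%:R * x ^+ n.
  rewrite /series /=; elim: n => [|n IHn].
    by rewrite !big_geq // bin_small // mulr0 mul0r subr0.
  rewrite !big_nat_recr //= mulrDr IHn /negbin addSn addnS !binS !natrD exprS; ring.
have cvgS : cvgn (series (negbin a.+1)).
  apply: nondecreasing_is_cvgn.
    by apply/nondecreasing_seqP => n; rewrite /series /= big_nat_recr //= lerDl negbin_ge0.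
  exists (((1 - x) ^+ a.+1)^-1 / (1 - x)) => _ [n _ <-].
  rewrite ler_pdivlMr // mulrC tele.
  apply: (@le_trans _ _ (series (negbin a) n)).
    by rewrite gerBl mulr_ge0 // exprn_ge0.
  rewrite -(cvg_lim _ IHa) //; apply: nondecreasing_cvgn_le; last exact: (cvgP _ IHa).
  by apply/nondecreasing_seqP => m; rewrite /series /= big_nat_recr //= lerDl negbin_ge0.
have rem : 'C(n + a, a.+1)%:R * x ^+ n @[n --> \oo] --> (0 : R).
  rewrite -cvg_shiftS /=.
  have -> : (fun n => 'C(n.+1 + a, a.+1)%:R * x ^+ n.+1) = (fun n => negbin a.+1 n * x).
    by apply/funext => n; rewrite /negbin addSnnS exprSr mulrA.
  have : negbin a.+1 n * x @[n --> \oo] --> 0 * x.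
    by apply: cvgMr_tmp; exact: cvg_series_cvg_0.
  by rewrite mul0r.
have -> : series (negbin a.+1) =
   (fun n => (series (negbin a) n - 'C(n + a, a.+1)%:R * x ^+ n) * (1 - x)^-1).
  by apply/funext => n; rewrite -tele mulrAC mulfV ?mul1r // gt_eqF.
rewrite exprSr invfM -[((1 - x) ^+ a.+1)^-1]subr0; apply: cvgMr_tmp.
exact: cvgB.
Qed.

Lemma negbin_moment_cvg a : series (fun m => m%:R * negbin a m) n @[n --> \oo] -->
  a.+1%:R * x / (1 - x) ^+ a.+2.
Proof.
rewrite -cvg_shiftS /=.
have -> : (fun n => series (fun m => m%:R * negbin a m) n.+1) =
    (fun n => a.+1%:R * x * series (negbin a.+1) n).
  apply/funext => n; rewrite /series /= big_nat_recl //= mul0r add0r mulr_sumr.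
  apply: eq_bigr => m _; rewrite /negbin mulrA -natrM.
  have -> : (m.+1 * 'C(m.+1 + a, a) = a.+1 * 'C(m + a.+1, a.+1))%N.
    by rewrite addSnnS mul_bin_left; congr (_ * _)%N; lia.
  by rewrite natrM exprS; ring.
by apply: cvgMl_tmp; exact: negbin_cvg.
Qed.

Variable k : nat.

Lemma Spoly_horner : (Spoly R k.+1).[x] = \sum_(j < k.+1) ('C(k, j) ^ 2)%:R * x ^+ j.
Proof.
by rewrite /Spoly horner_sum; apply: eq_bigr => j _; rewrite !hornerE.
Qed.

Lemma Spoly_deriv_horner :
  x * (Spoly R k.+1)^`().[x] = \sum_(j < k.+1) ('C(k, j) ^ 2)%:R * (j%:R * x ^+ j).
Proof.
rewrite /Spoly raddf_sum /= horner_sum mulr_sumr; apply: eq_bigr => j _.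
rewrite derivZ derivXn hornerZ hornerMn hornerXn -mulr_natr.
case: (nat_of_ord j) => [|i] /=; first by rewrite mul0r !mulr0.
by rewrite exprS; ring.
Qed.

Lemma sqbin_coef_cvg a : series (fun d => (sqbin_coef k a d)%:R * x ^+ d) n @[n --> \oo] -->
  (Spoly R k.+1).[x] / (1 - x) ^+ a.+1.
Proof.
have -> : series (fun d => (sqbin_coef k a d)%:R * x ^+ d) =
   (fun n => \sum_(j < k.+1) ('C(k, j) ^ 2)%:R * x ^+ j *
       series (fun d => if (j <= d)%N then negbin a (d - j)%N else 0) n).
  apply/funext => n; under [RHS]eq_bigr => j _ do rewrite /series /= mulr_sumr.
  rewrite exchange_big /=; apply: eq_bigr => d _.
  rewrite /sqbin_coef natr_sum mulr_suml; apply: eq_bigr => j _.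
  case: ifP => jd; last by rewrite mul0r mulr0.
  have -> : x ^+ d = x ^+ j * x ^+ (d - j) by rewrite -exprD subnKC.
  by rewrite /negbin natrM; ring.
rewrite Spoly_horner mulr_suml; apply: cvg_sum_ord => j; apply: cvgMl_tmp.
exact/cvg_series_shift/negbin_cvg.
Qed.

(** Writing [d = j + (d - j)] produces the two terms of [x] times the derivative of
    [S_k(x) / (1 - x) ^ (a + 1)]. *)
Lemma sqbin_coef_moment_cvg a :
  series (fun d => d%:R * ((sqbin_coef k a d)%:R * x ^+ d)) n @[n --> \oo] -->
  x * (Spoly R k.+1)^`().[x] / (1 - x) ^+ a.+1
  + a.+1%:R * x * (Spoly R k.+1).[x] / (1 - x) ^+ a.+2.
Proof.
have -> : series (fun d => d%:R * ((sqbin_coef k a d)%:R * x ^+ d)) =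
   (fun n => \sum_(j < k.+1) (('C(k, j) ^ 2)%:R * (j%:R * x ^+ j) *
       series (fun d => if (j <= d)%N then negbin a (d - j)%N else 0) n
     + ('C(k, j) ^ 2)%:R * x ^+ j * series (fun d => if (j <= d)%N then
         ((d - j)%N%:R * negbin a (d - j)%N) else 0) n)).
  apply/funext => n.
  under [RHS]eq_bigr => j _ do rewrite /series /= 2!mulr_sumr -big_split /=.
  rewrite exchange_big /=; apply: eq_bigr => d _.
  rewrite /sqbin_coef natr_sum mulr_suml mulr_sumr; apply: eq_bigr => j _.
  case: ifP => jd; last by rewrite mul0r !mulr0 addr0.
  have -> : x ^+ d = x ^+ j * x ^+ (d - j) by rewrite -exprD subnKC.
  have -> : d%:R = j%:R + (d - j)%:R :> R by rewrite -natrD subnKC.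
  by rewrite /negbin natrM; ring.
rewrite Spoly_deriv_horner Spoly_horner !(mulr_suml, mulr_sumr) -big_split /=.
apply: cvg_sum_ord => j; apply: cvgD.
  by apply: cvgMl_tmp; exact/cvg_series_shift/negbin_cvg.
have -> : a.+1%:R * x * (('C(k, j) ^ 2)%:R * x ^+ j) / (1 - x) ^+ a.+2
  = ('C(k, j) ^ 2)%:R * x ^+ j * (a.+1%:R * x / (1 - x) ^+ a.+2) by ring.
apply: cvgMl_tmp.
exact: (@cvg_series_shift _ (fun m => m%:R * negbin a m) j _ (@negbin_moment_cvg a)).
Qed.

End NegBinomialSeries.

(** Adding the double sum to its copy with [r] and [s] exchanged leaves terms
    [(e s - e r) (s - r) >= 0]. The statement is multiplied through by the total weight. *)
Lemma chebyshev_sum (R : realFieldType) (S : nat) (w e : nat -> R) :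
  (forall s, 0 <= w s) -> (forall s, (s < S)%N -> e s <= e s.+1) ->
  0 <= \sum_(s < S.+1) w s * e s
         * (s%:R * \sum_(r < S.+1) w r - \sum_(r < S.+1) r%:R * w r).
Proof.
move=> w0 emono.
have mono r s : (r <= s)%N -> (s <= S)%N -> e r <= e s.
  elim: s => [|s IHs]; first by rewrite leqn0 => /eqP->.
  rewrite leq_eqVlt => /orP[/eqP->//|]; rewrite ltnS => rs sS.
  by apply: le_trans (emono _ sS); apply: IHs => //; apply: ltnW.
set X := (X in 0 <= X).
have X1 : X = \sum_(s < S.+1) \sum_(r < S.+1) w s * w r * (e s * (s%:R - r%:R)).
  apply: eq_bigr => s _; rewrite mulr_sumr -sumrB mulr_sumr.
  by apply: eq_bigr => r _; ring.
have X2 : X = \sum_(s < S.+1) \sum_(r < S.+1) w s * w r * (e r * (r%:R - s%:R)).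
  rewrite X1 exchange_big; apply: eq_bigr => s _; apply: eq_bigr => r _.
  by congr (_ * _); rewrite mulrC.
suff : 0 <= X + X by lra.
rewrite {1}X1 X2 -big_split; apply: sumr_ge0 => s _ /=.
rewrite -big_split; apply: sumr_ge0 => r _ /=.
have -> : w s * w r * (e s * (s%:R - r%:R)) + w s * w r * (e r * (r%:R - s%:R))
   = w s * w r * ((e s - e r) * (s%:R - r%:R)) by ring.
apply: mulr_ge0; first exact: mulr_ge0.
have [rs|/ltnW sr] := leqP r s.
  by rewrite mulr_ge0 // subr_ge0 ?ler_nat // mono // -ltnS.
by rewrite -mulrNN !opprB mulr_ge0 // subr_ge0 ?ler_nat // mono // -ltnS.
Qed.

(** * The mean radius forced on outward-growing functions on a ball *)

Section BallMean.
Variables (R : realType) (k : nat) (t : R).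
Hypothesis t01 : 0 < t < 1.
Local Notation K := k.+1.

Let t0 : 0 < t. Proof. by case/andP: t01. Qed.
Let t1 : 0 < 1 - t. Proof. by rewrite subr_gt0; case/andP: t01. Qed.
Let t01' : 0 <= t < 1. Proof. by rewrite ltW //=; case/andP: t01. Qed.

Let wt s : R := (sqbin_coef k k.*2 s)%:R * t ^+ s.

Definition index_mean S : R :=
  series (fun s => s%:R * ((sqbin_coef k k.*2 s)%:R * t ^+ s)) S.+1
  / series (fun s => (sqbin_coef k k.*2 s)%:R * t ^+ s) S.+1.

(** The mean of [s] under the mixture cut at [S], less the negative binomial mean of the common part
    of the two compositions. *)
Definition ball_mean S : R := index_mean S - K%:R * t / (1 - t).

(** For [0 < k], the mean of [d] under the weights [shell_size K d * t ^ d], as [moment_cvg] shows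
    further on. Twice this value is the limiting distortion. *)
Definition limit_mean : R :=
  t * (k%:R / (1 - t) + (Spoly R K)^`().[t] / (Spoly R K).[t]).

Let wt_gt0 s : 0 < wt s.
Proof.
rewrite /wt sqbin_coef_double mulr_gt0 ?exprn_gt0 // ltr0n expn_gt0 bin_gt0.
by rewrite leq_addl.
Qed.

Let Swt_gt0 S : 0 < series wt S.+1.
Proof.
rewrite /series /= big_nat_recl //= ltr_pwDl //.
by apply: sumr_ge0 => i _; apply: ltW.
Qed.

Lemma Spoly_gt0 : 0 < (Spoly R K).[t].
Proof.
rewrite Spoly_horner big_ord_recl bin0 mul1r expr0 ltr_pwDl //.
by apply: sumr_ge0 => i _; rewrite mulr_ge0 // exprn_ge0 // ltW.
Qed.

Lemma index_mean_le S : index_mean S <= S%:R.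
Proof.
rewrite ler_pdivrMr; last exact: Swt_gt0.
rewrite /series /= mulr_sumr !big_mkord; apply: ler_sum => s _.
by rewrite ler_wpM2r ?(ltW (wt_gt0 _)) // ler_nat -ltnS.
Qed.

Lemma ball_mean_le S : ball_mean S <= S%:R.
Proof.
apply: le_trans (index_mean_le S); rewrite gerBl.
by rewrite mulr_ge0 ?invr_ge0 ?mulr_ge0 // ltW.
Qed.

(** The mean of [s] tends to [t] times the logarithmic derivative of [S_k(t) / (1 - t) ^ (2 k + 1)].
    Subtracting [K t / (1 - t)] reduces the coefficient [2 k + 1] to [k]. *)
Lemma ball_mean_cvg : ball_mean S @[S --> \oo] --> limit_mean.
Proof.
have S0 : (Spoly R K).[t] != 0 by rewrite gt_eqF // Spoly_gt0.
have T0 : 1 - t != 0 by rewrite gt_eqF.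
set d := (Spoly R K)^`().[t]; set q := (Spoly R K).[t] in S0 *.
have -> : limit_mean =
  (t * d / (1 - t) ^+ k.*2.+1 + k.*2.+1%:R * t * q / (1 - t) ^+ k.*2.+2)
   / (q / (1 - t) ^+ k.*2.+1) - K%:R * t / (1 - t).
  rewrite /limit_mean -/d -/q !exprS -!natr1 -[in k.*2%:R]addnn natrD.
  have : (1 - t) ^+ k.*2 != 0 by rewrite expf_neq0.
  by move: (_ ^+ _) => P P0; field; rewrite S0 T0 P0.
apply: cvgB; last exact: cvg_cst.
apply: cvgM.
  have := @sqbin_coef_moment_cvg R t t01' k k.*2.
  by rewrite -cvg_shiftS.
apply: cvgV; first by rewrite mulf_neq0 // invr_neq0 // expf_neq0.
have := @sqbin_coef_cvg R t t01' k k.*2.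
by rewrite -cvg_shiftS.
Qed.

(* The terms missing from the truncated sum are nonnegative as [index_mean S <= S]. *)
Let tail_bound S d : (d <= S)%N ->
  \sum_(s < S.+1 | (d <= s)%N) t ^+ s * 'C(s - d + k, k)%:R * (s%:R - index_mean S)
  <= t ^+ d / (1 - t) ^+ K * (d%:R - ball_mean S).
Proof.
move=> dS; set mu := index_mean S; pose f m : R := m%:R * negbin t k m + (d%:R - mu) * negbin t k m.
have fcvg : series f n @[n --> \oo] -->
    K%:R * t / (1 - t) ^+ K.+1 + (d%:R - mu) * ((1 - t) ^+ K)^-1.
  have -> : series f = (fun n => series (fun m => m%:R * negbin t k m) n
      + (d%:R - mu) * series (negbin t k) n).
    by apply/funext => n; rewrite /series /= mulr_sumr -big_split.
  apply: cvgD; first exact: (@negbin_moment_cvg _ _ t01' k).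
  by apply: cvgMl_tmp; exact: (@negbin_cvg _ _ t01' k).
have -> : \sum_(s < S.+1 | (d <= s)%N) t ^+ s * 'C(s - d + k, k)%:R * (s%:R - mu)
   = t ^+ d * series f (S - d).+1.
  rewrite /series /= mulr_sumr.
  rewrite -(big_mkord (fun s => (d <= s)%N) (fun s => t ^+ s * 'C(s - d + k, k)%:R * (s%:R - mu))).
  rewrite (big_cat_nat (n := d)) //=; last by rewrite leqW.
  rewrite big_nat_cond big1 ?add0r => [|i /andP[/andP[_ id] di]]; last by lia.
  rewrite -{1}[d]add0n big_addn subSn //; apply: eq_big => i; first by rewrite leq_addl.
  by move=> _; rewrite addnK /f /negbin exprD natrD; ring.
have -> : t ^+ d / (1 - t) ^+ K * (d%:R - ball_mean S) = t ^+ d *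
   (K%:R * t / (1 - t) ^+ K.+1 + (d%:R - mu) * ((1 - t) ^+ K)^-1).
  rewrite /ball_mean -/mu [(1 - t) ^+ K.+1]exprS; field.
  by rewrite expf_neq0 gt_eqF.
rewrite ler_wpM2l ?exprn_ge0 ?(ltW t0) // -(cvg_lim _ fcvg) //.
apply: limr_ge; first exact: (cvgP _ fcvg).
near=> n; have nS : ((S - d).+1 <= n)%N by near: n; exists (S - d).+1.
rewrite /series /= (big_cat_nat (n := (S - d).+1) (p := n)) //= lerDl big_nat_cond.
apply: sumr_ge0 => m /andP[/andP[Sm _] _].
rewrite /f -mulrDl mulr_ge0 ?negbin_ge0 // addrA subr_ge0 -natrD.
by apply: le_trans (index_mean_le S) _; rewrite ler_nat; lia.
Unshelve. all: by end_near. Qed.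

(** [b] is [a] with the weight [t ^ d] removed, hence grows along outward edges, and [E s / T s ^ 2]
    is its mean under the [s]-th law. Chebyshev correlates these means with [s]; summing over [s] at
    fixed [h] turns [s] into [d] plus a constant. *)
Lemma ball_sum_ge0 B S (g : hist K B) (a : hist K B -> R) :
  (forall i, (S <= g i)%N /\ (g i + S <= B)%N) ->
  (forall h, 0 <= a h) ->
  (forall h x y, balanced g h -> (excess h g < S)%N -> outward g h x y ->
     t * a h <= a (transfer x y h)) ->
  0 <= \sum_(h | balanced g h && (excess h g <= S)%N)
         a h * ((excess h g)%:R - ball_mean S).
Proof.
move=> gS a0 amono.
pose b h := a h / t ^+ excess h g.
pose E s := \sum_(h | balanced g h && (excess h g <= s)%N)
     'C(s - excess h g + k, k)%:R * b h.
pose T s : R := 'C(s + k, k)%:R.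
have T0 s : 0 < T s by rewrite ltr0n bin_gt0 leq_addl.
have TS s : s.+1%:R * T s.+1 = (s + K)%N%:R * T s.
  by rewrite /T -!natrM mul_bin_succ.
have wtE s : wt s = T s ^+ 2 * t ^+ s by rewrite /wt sqbin_coef_double natrX.
(* The factors [s + K] and [s + 1] of [mean_flow_le] form the growth ratio of [T], so the inequality
   compares means. *)
have eS s : (s < S)%N -> E s / T s ^+ 2 <= E s.+1 / T s.+1 ^+ 2.
  move=> sS; have gs i : (s < g i)%N /\ (g i + s < B)%N by have := gS i; lia.
  have flow := @mean_flow_le R k B s g gs b.
  rewrite ler_pdivrMr ?exprn_gt0 // mulrAC ler_pdivlMr ?exprn_gt0 //.
  rewrite -(ler_pM2l (x := s.+1%:R ^+ 2)) ?exprn_gt0 //.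
  have -> : s.+1%:R ^+ 2 * (E s * T s.+1 ^+ 2) = ((s + K)%N%:R ^+ 2 * E s) * T s ^+ 2.
    have -> : s.+1%:R ^+ 2 * (E s * T s.+1 ^+ 2) = E s * (s.+1%:R * T s.+1) ^+ 2 by ring.
    by rewrite TS; ring.
  rewrite [X in _ <= X]mulrA ler_wpM2r ?sqr_ge0 //; apply: flow => h x y bal hs O.
  have hS : (excess h g < S)%N by apply: leq_ltn_trans sS.
  have hB : (h x < B)%N.
    by case/and3P: O => _ gx _; have := excess_le g h x; have := gS x; lia.
  rewrite /b excess_transfer // ler_pdivlMr ?exprn_gt0 // exprS.
  have -> : a h / t ^+ excess h g * (t * t ^+ excess h g) = t * a h.
    by field; rewrite expf_neq0 // gt_eqF.
  exact: amono.
have w0 s : 0 <= wt s by apply: ltW.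
have := chebyshev_sum w0 eS.
have -> : \sum_(r < S.+1) wt r = series wt S.+1 by rewrite /series /= big_mkord.
have -> : \sum_(r < S.+1) r%:R * wt r = index_mean S * series wt S.+1.
  rewrite /index_mean -/wt mulfVK; first by rewrite /series /= big_mkord.
  by rewrite gt_eqF.
have -> : \sum_(s < S.+1) wt s * (E s / T s ^+ 2) *
      (s%:R * series wt S.+1 - index_mean S * series wt S.+1)
   = series wt S.+1 * \sum_(s < S.+1) t ^+ s * E s * (s%:R - index_mean S).
  rewrite [RHS]mulr_sumr; apply: eq_bigr => s _; rewrite wtE; field.
  by rewrite -[X in X != 0]/(T s) gt_eqF.
rewrite pmulr_rge0 // => H.
(* This is the total mass of the negative binomial law of the common part, the factor that
   [tail_bound] produces. *)
have P0 : 0 < ((1 - t) ^+ K)^-1 by rewrite invr_gt0 exprn_gt0.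
rewrite -(pmulr_rge0 _ P0); apply: le_trans H _.
have -> : \sum_(s < S.+1) t ^+ s * E s * (s%:R - index_mean S) =
  \sum_(h | balanced g h && (excess h g <= S)%N) b h *
    \sum_(s < S.+1 | (excess h g <= s)%N)
      t ^+ s * 'C(s - excess h g + k, k)%:R * (s%:R - index_mean S).
  under eq_bigr => s _ do rewrite /E mulrAC mulr_sumr.
  under [RHS]eq_bigr => h _ do rewrite mulr_sumr.
  rewrite (exchange_big_dep (fun h => balanced g h && (excess h g <= S)%N)) /=; last first.
    by move=> s h _ /andP[-> /leq_trans] /=; apply; rewrite -ltnS.
  apply: eq_bigr => h /andP[-> _]; apply: eq_bigr => s _; ring.
rewrite mulr_sumr; apply: ler_sum => h /andP[bal hS].
apply: le_trans (ler_wpM2l _ (tail_bound hS)) _.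
  by rewrite /b mulr_ge0 // invr_ge0 exprn_ge0 // ltW.
rewrite /b le_eqVlt; apply/orP; left; apply/eqP; field.
by rewrite !expf_neq0 // gt_eqF.
Qed.

End BallMean.

(** * The Ehrhart series *)

Lemma cvg_series_from1 (R : realType) (f : R ^nat) (l : R) :
  series f n @[n --> \oo] --> l ->
  \sum_(1 <= d < N) f d @[N --> \oo] --> l - f 0%N.
Proof.
move=> fl; rewrite -cvg_shiftS /=.
have -> : (fun N => \sum_(1 <= d < N.+1) f d) = (fun N => series f N.+1 - f 0%N).
  by apply/funext => N; rewrite /series /= [in RHS]big_nat_recl // addrAC subrr add0r big_add1.
by apply: cvgB; [rewrite cvg_shiftS | exact: cvg_cst].
Qed.

Section Ehrhart.
Variables (R : realType) (k : nat).
Hypothesis k0 : (0 < k)%N.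
Local Notation K := k.+1.

Lemma LP_series_cvg (x : R) : 0 <= x < 1 ->
  \sum_(1 <= d < N) (LP K d)%:R * x ^+ d @[N --> \oo] -->
    (Spoly R K).[x] / (1 - x) ^+ K - 1.
Proof.
move=> x01.
have H : series (fun d => (LP K d)%:R * x ^+ d) n @[n --> \oo] -->
    (Spoly R K).[x] / (1 - x) ^+ K.
  have -> : (fun d => (LP K d)%:R * x ^+ d) = (fun d => (sqbin_coef k k d)%:R * x ^+ d).
    by apply/funext => d; rewrite LPE.
  exact: (@sqbin_coef_cvg R x x01 k k).
have L0 : (LP K 0)%:R * x ^+ 0 = 1 by rewrite LP_shell big_ord1 mulr1.
by have := @cvg_series_from1 _ _ _ H; rewrite /= L0.
Qed.

Lemma Ehr_closed_form (x : R) : 0 <= x < 1 -> Ehr K x = (Spoly R K).[x] / (1 - x) ^+ K.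
Proof. by move=> x01; rewrite /Ehr (cvg_lim _ (LP_series_cvg x01)) // addrC subrK. Qed.

Lemma shell_series_cvg (x : R) : 0 <= x < 1 ->
  \sum_(1 <= d < N) (shell_size K d)%:R * x ^+ d / (1 - x) @[N --> \oo] -->
    (Spoly R K).[x] / (1 - x) ^+ K - 1 / (1 - x).
Proof.
move=> x01.
have H : series (fun d => (shell_size K d)%:R * x ^+ d / (1 - x)) n @[n --> \oo] -->
    (Spoly R K).[x] / (1 - x) ^+ K.
  rewrite (_ : series _ =
    (fun n => series (fun d => (sqbin_coef k k.-1 d)%:R * x ^+ d) n * (1 - x)^-1)).
    rewrite exprSr invfM mulrA; apply: cvgMr_tmp.
    by have := @sqbin_coef_cvg R x x01 k k.-1; rewrite prednK.
  apply/funext => n; rewrite /series /= mulr_suml; apply: eq_bigr => d _.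
  by rewrite shell_sizeE.
by have := @cvg_series_from1 _ _ _ H; rewrite /= mulr1.
Qed.

(** [Ehr] is defined through a limit and its closed form is known for [0 <= z < 1]; agreement near
    [x] suffices. Both numerator and denominator are treated as polynomials. *)
Lemma Ehr_is_derive (x : R) : 0 < x < 1 ->
  is_derive x 1 (Ehr K) ((Spoly R K)^`().[x] / (1 - x) ^+ K
    + K%:R * (Spoly R K).[x] / (1 - x) ^+ K.+1).
Proof.
move=> /andP[x0 x1]; have y0 : 1 - x != 0 by rewrite gt_eqF // subr_gt0.
pose Q : {poly R} := (1%:P - 'X) ^+ K.
have QE z : Q.[z] = (1 - z) ^+ K by rewrite /Q !hornerE.
have dQ : Q^`().[x] = - (K%:R * (1 - x) ^+ k).
  by rewrite /Q deriv_exp derivB derivC derivX sub0r hornerMn !hornerE -mulr_natl /=; ring.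
apply: (@near_eq_is_derive _ _ _ (horner (Spoly R K) * (fun z => (Q.[z])^-1))).
  near=> z.
  have : z \in `]0, 1[ by near: z; apply: near_in_itvoo; rewrite in_itv /= x0.
  rewrite in_itv /= => /andP[z0 z1].
  by rewrite Ehr_closed_form ?(ltW z0) // -QE.
have D1 : is_derive x 1 (fun z => (Q.[z])^-1) (- Q.[x] ^- 2 *: Q^`().[x]).
  by apply: is_deriveV; rewrite QE expf_neq0.
have D2 := is_deriveM (is_derive_poly (Spoly R K) x) D1.
apply: (trigger_derive D2).
rewrite dQ QE /GRing.scale /= !exprS.
have : (1 - x) ^+ k != 0 by rewrite expf_neq0.
move: (_ ^+ k) => P P0; field; rewrite P0.
Unshelve. all: by end_near. Qed.

(** The logarithmic derivative of [S_k(x) / (1 - x) ^ K] contains [K / (1 - x)], and the subtracted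
    term lowers [K] to [k]. *)
Lemma Ehr_log_derivative (x : R) : 0 < x < 1 ->
  2 * x / Ehr K x * derive1 (Ehr K) x - 2 * x / (1 - x) = 2 * limit_mean k x.
Proof.
move=> x01; have /andP[x0 x1] := x01.
have D := Ehr_is_derive x01.
rewrite derive1E derive_val Ehr_closed_form ?(ltW x0) // /limit_mean.
have S0 := Spoly_gt0 k x01.
have y0 : 1 - x != 0 by rewrite gt_eqF // subr_gt0.
have : (1 - x) ^+ k != 0 by rewrite expf_neq0.
rewrite !exprS -[k.+1%:R]natr1; set P := (1 - x) ^+ k => P0.
by field; rewrite P0 y0 gt_eqF.
Qed.

End Ehrhart.

(** * The multinomial distribution *)

Section Multinomial.
Variables (R : realType) (K : nat) (p : 'I_K -> R).

Definition multinom_pmf n (h : hist K n) : R :=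
  multinom R h * \prod_(k < K) p k ^+ h k.

Lemma prod_fact_gt0 n (h : hist K n) : 0 < \prod_(k < K) (h k)`!%:R :> R.
Proof. by apply: prodr_gt0 => k _; rewrite ltr0n fact_gt0. Qed.

Let bump_bin n (h : hist K n) (k : 'I_K) : hist K n.+1 :=
  [ffun i => inord (if i == k then (h i).+1 else h i)].

Let lower_bin n (k : 'I_K) (h : hist K n.+1) : hist K n :=
  [ffun i => inord (if i == k then (h i).-1 else h i)].

Let bump_binE n (h : hist K n) k i :
  bump_bin h k i = (if i == k then (h i).+1 else h i) :> nat.
Proof. by rewrite ffunE inordK //; case: eqP => _; have := ltn_ord (h i); lia. Qed.

Let lower_binE n (h : hist K n.+1) k i : h \in Hn K n.+1 -> (0 < h k)%N ->
  lower_bin k h i = (if i == k then (h i).-1 else h i) :> nat.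
Proof.
rewrite inE => /eqP hn hk; rewrite ffunE inordK //; move: hn.
case: eqP => [-> _|/eqP ik]; first by have := ltn_ord (h k); lia.
by rewrite (bigD1 i) //= (bigD1 k) 1?eq_sym //=; lia.
Qed.

(** Removes one record from bin [k]. With [multinom_pmf_succ] it turns a sum weighted by [h k] into
    a sum over [n] records; the total mass and both moments follow from it. *)
Lemma sum_hist_succ n k (G : hist K n.+1 -> R) (G' : hist K n -> R) :
  (forall (h : hist K n.+1) (h' : hist K n), h \in Hn K n.+1 -> h' \in Hn K n ->
     (h k = (h' k).+1 :> nat) -> (forall i, i != k -> h i = h' i :> nat) ->
     G h = G' h') ->
  (forall h : hist K n.+1, h k = 0%N :> nat -> G h = 0) ->
  \sum_(h in Hn K n.+1) G h = \sum_(h in Hn K n) G' h.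
Proof.
move=> GG' G0; rewrite (bigID (fun h : hist K n.+1 => (0 < h k)%N)) /=.
rewrite [X in _ + X]big1 ?addr0; last first.
  by move=> h /andP[_]; rewrite lt0n negbK => /eqP /G0.
have bH h : (bump_bin h k \in Hn K n.+1) = (h \in Hn K n).
  rewrite !inE (bigD1 k) //= [in RHS](bigD1 k) //= bump_binE eqxx addSn eqSS.
  congr (_ + _ == _)%N; apply: eq_bigr => i ik.
  by rewrite bump_binE (negPf ik).
rewrite (reindex_onto (fun h : hist K n => bump_bin h k) (lower_bin k)) /=; last first.
  move=> h /andP[hn hk]; apply/ffunP => i; apply: val_inj => /=.
  rewrite bump_binE lower_binE //; case: eqP => [->|//]; exact: prednK.
apply: eq_big => [h|h /andP[/andP[hn _] _]].
  rewrite bH bump_binE eqxx /=; case hn : (h \in Hn K n) => //=.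
  apply/eqP/ffunP => i; apply: val_inj => /=.
  rewrite lower_binE ?bH // ?bump_binE ?eqxx //.
  by case: eqP.
apply: GG' => //; first by rewrite -bH.
  by rewrite bump_binE eqxx.
by move=> i ik; rewrite bump_binE (negPf ik).
Qed.

Lemma multinom_pmf_succ n (k : 'I_K) (h : hist K n.+1) (h' : hist K n) :
  h k = (h' k).+1 :> nat -> (forall i, i != k -> h i = h' i :> nat) ->
  (h k)%:R * multinom_pmf h = n.+1%:R * p k * multinom_pmf h'.
Proof.
move=> hk hi; rewrite /multinom_pmf /multinom.
rewrite (bigD1 (F := fun i => (h i)`!%:R) k) //= (bigD1 (F := fun i => (h' i)`!%:R) k) //=.
rewrite (bigD1 (F := fun i => p i ^+ h i) k) //= (bigD1 (F := fun i => p i ^+ h' i) k) //=.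
rewrite (eq_bigr (F1 := fun i => (h i)`!%:R) (fun i => (h' i)`!%:R)); last by move=> i /hi ->.
rewrite (eq_bigr (F1 := fun i => p i ^+ h i) (fun i => p i ^+ h' i)); last by move=> i /hi ->.
have : \prod_(i < K | i != k) (h' i)`!%:R != 0 :> R.
  by rewrite prodf_seq_neq0; apply/allP => i _; apply/implyP => _; rewrite pnatr_eq0 -lt0n fact_gt0.
have : (h' k)`!%:R != 0 :> R by rewrite pnatr_eq0 -lt0n fact_gt0.
have : 1 + (h' k)%:R != 0 :> R by rewrite nat1r pnatr_eq0.
rewrite hk !factS !natrM exprS.
by move=> A B C; field; rewrite ?A ?B ?C.
Qed.

(** The ratio of neighboring weights, cross-multiplied; it is close to 1 when [h] is close to
    [n p]. *)
Lemma multinom_pmf_transfer n (a b : 'I_K) (h : hist K n) :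
  a != b -> (h a < n)%N -> (0 < h b)%N ->
  (h a).+1%:R * p b * multinom_pmf (transfer a b h)
    = (h b)%:R * p a * multinom_pmf h.
Proof.
move=> ab ha hb; have ba : b != a by rewrite eq_sym.
rewrite /multinom_pmf /multinom.
rewrite (bigD1 (F := fun i => (h i)`!%:R) a) //=
  (bigD1 (F := fun i => (transfer a b h i)`!%:R) a) //=.
rewrite (bigD1 (F := fun i => (h i)`!%:R) b) //=
  (bigD1 (F := fun i => (transfer a b h i)`!%:R) b) //=.
rewrite (bigD1 (F := fun i => p i ^+ h i) a) //=
  (bigD1 (F := fun i => p i ^+ transfer a b h i) a) //=.
rewrite (bigD1 (F := fun i => p i ^+ h i) b) //=
  (bigD1 (F := fun i => p i ^+ transfer a b h i) b) //=.
rewrite (eq_bigr (F1 := fun i => (transfer a b h i)`!%:R) (fun i => (h i)`!%:R)); last first.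
  by move=> i /andP[ia ib]; rewrite transfer3.
rewrite (eq_bigr (F1 := fun i => p i ^+ transfer a b h i) (fun i => p i ^+ h i)); last first.
  by move=> i /andP[ia ib]; rewrite transfer3.
rewrite transfer1 // transfer2 //.
have : \prod_(i < K | (i != a) && (i != b)) (h i)`!%:R != 0 :> R.
  by rewrite prodf_seq_neq0; apply/allP => i _; apply/implyP => _; rewrite pnatr_eq0 -lt0n fact_gt0.
case: (nat_of_ord (h b)) hb => // m _ /=.
have : (h a)`!%:R != 0 :> R by rewrite pnatr_eq0 -lt0n fact_gt0.
have : m`!%:R != 0 :> R by rewrite pnatr_eq0 -lt0n fact_gt0.
have : 1 + (h a)%:R != 0 :> R by rewrite nat1r pnatr_eq0.
have : 1 + m%:R != 0 :> R by rewrite nat1r pnatr_eq0.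
rewrite !factS !natrM !exprS.
by move=> A B C D E; field; rewrite ?A ?B ?C ?D ?E.
Qed.

Hypothesis p0 : forall k, 0 < p k.
Hypothesis p1 : \sum_(k < K) p k = 1.

Lemma prob_le1 x : p x <= 1.
Proof. by rewrite -p1 (bigD1 x) //= lerDl sumr_ge0 // => i _; apply: ltW. Qed.

(** The product serves as an explicit positive lower bound common to all [p x]. *)
Lemma prod_prob_le x : \prod_y p y <= p x.
Proof.
rewrite (bigD1 x) //= ler_piMr ?(ltW (p0 x)) // prodr_ile1 // => i _.
by rewrite prob_le1 ltW.
Qed.

Lemma multinom_pmf_gt0 n (h : hist K n) : 0 < multinom_pmf h.
Proof.
rewrite mulr_gt0 ?prodr_gt0 // => [|k _]; last by rewrite exprn_gt0.
by rewrite divr_gt0 ?prod_fact_gt0 // ltr0n fact_gt0.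
Qed.

(** Since the coordinates of [h] sum to [n + 1], the mass for [n + 1] records splits into
    size-biased sums over the bins, each reduced to [n] records. *)
Lemma sum_multinom_pmf n : \sum_(h in Hn K n) multinom_pmf h = 1.
Proof.
elim: n => [|n IHn].
  rewrite (big_pred1 [ffun => ord0]) => [|h].
    rewrite /multinom_pmf /multinom !big1 ?divr1 ?mulr1 // => k _; rewrite ffunE //.
  rewrite inE; apply/eqP/eqP => [h0|->].
    by apply/ffunP => k; rewrite ffunE ord1.
  by rewrite big1 // => k _; rewrite ffunE.
apply: (@mulfI _ n.+1%:R); first by rewrite pnatr_eq0.
rewrite mulr1 mulr_sumr.
transitivity (\sum_(h in Hn K n.+1) \sum_k (h k)%:R * multinom_pmf h).
  apply: eq_bigr => h; rewrite inE => /eqP hn.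
  by rewrite -mulr_suml -natr_sum hn.
rewrite exchange_big /= -[RHS]mulr1 -[X in _ = _ * X]p1 mulr_sumr; apply: eq_bigr => k _.
rewrite (@sum_hist_succ n k _ (fun h => n.+1%:R * p k * multinom_pmf h)).
- by rewrite -mulr_sumr IHn mulr1.
- by move=> h h' _ _; exact: multinom_pmf_succ.
- by move=> h ->; rewrite mul0r.
Qed.

Lemma multinom_pmf_mean n k :
  \sum_(h in Hn K n) (h k)%:R * multinom_pmf h = n%:R * p k.
Proof.
case: n => [|n].
  by rewrite big1 ?mul0r // => h _; rewrite (ord1 (h k)) mul0r.
rewrite (@sum_hist_succ n k _ (fun h => n.+1%:R * p k * multinom_pmf h)).
- by rewrite -mulr_sumr sum_multinom_pmf mulr1.
- by move=> h h' _ _; exact: multinom_pmf_succ.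
- by move=> h ->; rewrite mul0r.
Qed.

Lemma multinom_pmf_moment2 n k :
  \sum_(h in Hn K n) (h k)%:R ^+ 2 * multinom_pmf h
  = n%:R * p k * (1 + n.-1%:R * p k).
Proof.
case: n => [|n].
  by rewrite big1 ?mul0r // => h _; rewrite (ord1 (h k)) expr0n mul0r.
rewrite (@sum_hist_succ n k _ (fun h => n.+1%:R * p k * multinom_pmf h
   + n.+1%:R * p k * ((h k)%:R * multinom_pmf h))).
- by rewrite big_split /= -!mulr_sumr multinom_pmf_mean sum_multinom_pmf; ring.
- move=> h h' _ _ hk hi; rewrite expr2 -mulrA (multinom_pmf_succ hk hi) hk.
  by rewrite -[(h' k).+1%:R]natr1; ring.
- by move=> h ->; rewrite expr0n mul0r.
Qed.

Lemma multinom_pmf_variance n k :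
  \sum_(h in Hn K n) ((h k)%:R - n%:R * p k) ^+ 2 * multinom_pmf h <= n%:R.
Proof.
have -> : \sum_(h in Hn K n) ((h k)%:R - n%:R * p k) ^+ 2 * multinom_pmf h
  = \sum_(h in Hn K n) (h k)%:R ^+ 2 * multinom_pmf h
    - 2 * (n%:R * p k) * \sum_(h in Hn K n) (h k)%:R * multinom_pmf h
    + (n%:R * p k) ^+ 2 * \sum_(h in Hn K n) multinom_pmf h.
  rewrite !mulr_sumr -sumrB -big_split; apply: eq_bigr => h _ /=; ring.
rewrite multinom_pmf_moment2 multinom_pmf_mean sum_multinom_pmf.
have pk1 := prob_le1 k.
case: n => [|n]; first by rewrite !(mulr0n, mul0r, mulr0, subr0, add0r, expr0n).
have -> : n.+1%:R * p k * (1 + n.+1.-1%:R * p k) - 2 * (n.+1%:R * p k) * (n.+1%:R * p k) +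
   (n.+1%:R * p k) ^+ 2 * 1 = n.+1%:R * (p k * (1 - p k)) by rewrite -natr1; ring.
rewrite ler_piMr // mulr_ile1 ?subr_ge0 ?(ltW (p0 k)) // gerBl; exact: ltW.
Qed.

Definition deviates n (r : R) (h : hist K n) :=
  [exists k, r < `|(h k)%:R - n%:R * p k|].

(** Chebyshev's inequality in each coordinate and a union bound. *)
Lemma multinom_pmf_deviates n r : 0 < r ->
  \sum_(h in Hn K n | deviates r h) multinom_pmf h <= K%:R * (n%:R / r ^+ 2).
Proof.
move=> r0; have r20 : 0 < r ^+ 2 by rewrite exprn_gt0.
have -> : K%:R * (n%:R / r ^+ 2) = \sum_(k < K) n%:R / r ^+ 2.
  by rewrite sumr_const card_ord mulr_natl.
apply: (@le_trans _ _ (\sum_(k < K) \sum_(h in Hn K n)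
    ((h k)%:R - n%:R * p k) ^+ 2 * multinom_pmf h / r ^+ 2)); last first.
  apply: ler_sum => k _; rewrite -mulr_suml ler_wpM2r ?invr_ge0 ?(ltW r20) //.
  exact: multinom_pmf_variance.
rewrite exchange_big /= big_mkcondr; apply: ler_sum => h _.
have pos k : 0 <= ((h k)%:R - n%:R * p k) ^+ 2 * multinom_pmf h / r ^+ 2.
  by rewrite divr_ge0 ?(ltW r20) // mulr_ge0 ?sqr_ge0 // ltW // multinom_pmf_gt0.
case: ifP => [/existsP[k rk]|_]; last by apply: sumr_ge0.
rewrite (bigD1 k) //= -[X in X <= _]addr0 lerD ?sumr_ge0 //.
rewrite ler_pdivlMr // mulrC ler_wpM2r ?(ltW (multinom_pmf_gt0 _)) //.
by rewrite -[X in _ <= X]real_normK ?num_real // lerXn2r ?nnegrE ?(ltW r0) // ltW.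
Qed.

End Multinomial.

(** * The lower bound *)

Lemma l1z_excess K n (h g : hist K n) :
  l1z (hz h) (hz g) = (excess h g + excess g h)%N.
Proof.
by rewrite /l1z /excess -big_split; apply: eq_bigr => k _ /=; rewrite /hz; lia.
Qed.

Lemma Hn_balanced K n (h g : hist K n) : g \in Hn K n ->
  (h \in Hn K n) = balanced g h.
Proof.
rewrite !inE /balanced => /eqP gn.
suff : ((\sum_k h k)%N + excess g h = (\sum_k g k)%N + excess h g)%N.
  rewrite gn; move: (excess h g) (excess g h) (\sum_k _)%N => a b c E.
  by apply/eqP/eqP; lia.
by rewrite -!big_split; apply: eq_bigr => k _ /=; lia.
Qed.

Lemma l1z_balanced K n (h g : hist K n) : h \in Hn K n -> g \in Hn K n ->
  l1z (hz h) (hz g) = (excess h g).*2.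
Proof.
by move=> hn gn; rewrite l1z_excess -addnn; move: hn; rewrite (Hn_balanced _ gn) => /eqP->.
Qed.

Lemma transfer_Hn K n x y (h : hist K n) : x != y -> (h x < n)%N -> (0 < h y)%N ->
  h \in Hn K n -> transfer x y h \in Hn K n.
Proof.
move=> xy hx hy; rewrite !inE => /eqP hn.
have yx : y != x by rewrite eq_sym.
move: hn; rewrite (bigD1 x) //= (bigD1 y) //= => hn.
rewrite (bigD1 x) //= (bigD1 y) //= transfer1 // transfer2 // -[X in _ == X]hn.
rewrite (eq_bigr (fun i => h i : nat)); first by move: (bigop _ _ _) => c; apply/eqP; lia.
by move=> i /andP[ix iy]; rewrite transfer3.
Qed.

Lemma neighbor_transfer K n x y (h : hist K n) : x != y -> (h x < n)%N -> (0 < h y)%N ->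
  neighbor h (transfer x y h).
Proof.
move=> xy hx hy; have yx : y != x by rewrite eq_sym.
rewrite /neighbor /l1z (bigD1 x) //= (bigD1 y) //= big1 => [|i /andP[ix iy]].
  by rewrite /hz transfer1 // transfer2 //; lia.
by rewrite /hz transfer3 // subrr.
Qed.

Lemma excess_close K n (h g : hist K n) S x : balanced g h -> (excess h g <= S)%N ->
  (h x <= g x + S)%N /\ (g x <= h x + S)%N.
Proof.
by move=> /eqP bal; have := excess_le h g x; have := excess_le g h x; rewrite -bal; lia.
Qed.

Lemma excess_interior K n (h g : hist K n) S x : balanced g h -> (excess h g < S)%N ->
  (S <= g x)%N -> (g x + S <= n)%N -> (h x < n)%N /\ (0 < h x)%N.
Proof.
by move=> /eqP bal; have := excess_le h g x; have := excess_le g h x; rewrite -bal; lia.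
Qed.

Section LowerBound.
Variables (R : realType) (k n : nat) (p : 'I_k.+1 -> R) (theta t : R).
Local Notation K := k.+1.
Hypotheses (p0 : forall x, 0 < p x) (p1 : \sum_x p x = 1).
Hypothesis other : forall x : 'I_K, exists y, y != x.
Hypotheses (t0 : 0 < t) (tth : t < theta) (th1 : theta < 1).
Variable W : mech R K n.
Hypotheses (hsmW : isHSM W) (dpW : isDP theta W).

Let P := @multinom_pmf R K p n.

Let P0 h : 0 < P h. Proof. exact: multinom_pmf_gt0. Qed.

Lemma Dn_excess : Dn W p =
  2 * \sum_(g in Hn K n) \sum_(h in Hn K n) P h * W g h * (excess h g)%:R.
Proof.
rewrite /Dn exchange_big /= mulr_sumr; apply: eq_bigr => g gn.
rewrite mulr_sumr; apply: eq_bigr => h hn.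
by rewrite l1z_balanced // -muln2 natrM /P /multinom_pmf; ring.
Qed.

(** The bound is proved for each output [g]. Inputs outside the ball are at distance above [S],
    hence above [ball_mean]. If [g] is within [eta n] of the mean, [ball_sum_ge0] handles the ball.
    Otherwise every input in the ball is off by more than [eta n / 2], as [S] is smaller, and loses
    at most [S]; these losses add up to the deviation probability. *)
Lemma Dn_ge_ball_mean S (eta : R) :
  (forall x y, t * p y * (p x + 2 * eta) <= theta * p x * (p y - 2 * eta)) ->
  (forall x, S%:R <= (p x - eta) * n%:R) ->
  S.+1%:R <= eta * n%:R / 2 ->
  2 * (ball_mean k t S -
    S%:R * \sum_(h in Hn K n | deviates p (eta * n%:R / 2) h) P h) <= Dn W p.
Proof.
move=> Heta Hn1 Hn2; set delta := ball_mean k t S.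
have t1 : 0 < t < 1 by rewrite t0 (lt_trans tth).
have dS : delta <= S%:R by exact: ball_mean_le.
have th0 : 0 < theta := lt_trans t0 tth.
have en0 : 0 < eta * n%:R by have : 0 < S.+1%:R :> R; [by [] | lra].
rewrite Dn_excess ler_pM2l //.
have sumW : \sum_(g in Hn K n) \sum_(h in Hn K n) P h * W g h = 1.
  rewrite exchange_big /= -[RHS](sum_multinom_pmf p1 n); apply: eq_bigr => h hn.
  by rewrite -mulr_sumr (hsmW hn).2 mulr1.
have W0 g h : g \in Hn K n -> h \in Hn K n -> 0 <= P h * W g h.
  by move=> gn hn; rewrite mulr_ge0 ?(ltW (P0 _)) // (hsmW hn).1.
suff main g : g \in Hn K n ->
  - \sum_(h in Hn K n | deviates p (eta * n%:R / 2) h) S%:R * (P h * W g h)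
  <= \sum_(h in Hn K n) P h * W g h * ((excess h g)%:R - delta).
  have := @ler_sum R _ (index_enum _) (fun g => g \in Hn K n) _ _ main.
  rewrite sumrN exchange_big /=.
  have -> : \sum_(h in Hn K n | deviates p (eta * n%:R / 2) h)
      \sum_(g in Hn K n) S%:R * (P h * W g h)
      = S%:R * \sum_(h in Hn K n | deviates p (eta * n%:R / 2) h) P h.
    rewrite mulr_sumr; apply: eq_bigr => h /andP[hn _].
    by rewrite -!mulr_sumr (hsmW hn).2 mulr1.
  have -> : \sum_(g in Hn K n) \sum_(h in Hn K n) P h * W g h * ((excess h g)%:R - delta)
    = \sum_(g in Hn K n) \sum_(h in Hn K n) P h * W g h * (excess h g)%:R - delta.
    rewrite -[delta in RHS]mulr1 -sumW mulr_sumr -sumrB; apply: eq_bigr => g gn.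
    by rewrite mulr_sumr -sumrB; apply: eq_bigr => h hn; ring.
  by rewrite lerBrDr addrC.
move=> gn.
have close h : h \in Hn K n -> (excess h g <= S)%N ->
  forall x, `|(h x)%:R - (g x)%:R| <= S%:R :> R.
  move=> hn hS x; rewrite (Hn_balanced _ gn) in hn.
  have [A B] := excess_close x hn hS.
  have U : (h x)%:R <= (g x)%:R + S%:R :> R by rewrite -natrD ler_nat.
  have V : (g x)%:R <= (h x)%:R + S%:R :> R by rewrite -natrD ler_nat.
  by rewrite ler_norml; lra.
have [bad|good] := boolP (deviates p (eta * n%:R) g).
  rewrite -sumrN big_mkcondr; apply: ler_sum => h hn.
  have [hS|hS] := leqP (excess h g) S; last first.
    apply: (@le_trans _ _ 0).
      by case: ifP => // _; rewrite oppr_le0 mulr_ge0 // W0.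
    by rewrite mulr_ge0 ?W0 // subr_ge0 (le_trans dS) // ler_nat ltnW.
  have -> : deviates p (eta * n%:R / 2) h.
    case/existsP: bad => x bad; apply/existsP; exists x.
    have := close h hn hS x.
    have : S%:R <= eta * n%:R / 2 by apply: le_trans Hn2; rewrite ler_nat.
    have := ler_normD ((g x)%:R - (h x)%:R) ((h x)%:R - n%:R * p x).
    rewrite addrA subrK [`|(g x)%:R - (h x)%:R|]distrC; lra.
  rewrite mulrC -mulrN ler_wpM2l ?W0 //.
  have : 0 <= (excess h g)%:R :> R by []; lra.
apply: (@le_trans _ _ 0).
  rewrite oppr_le0; apply: sumr_ge0 => h /andP[hn _]; by rewrite mulr_ge0 ?W0.
have gx x : `|(g x)%:R - n%:R * p x| <= eta * n%:R.
  by move: good => /existsPn/(_ x); rewrite -leNgt.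
rewrite (bigID (fun h => (excess h g <= S)%N)) /= addr_ge0 //; last first.
  apply: sumr_ge0 => h /andP[hn]; rewrite -ltnNge => /ltnW hS.
  by rewrite mulr_ge0 ?W0 // subr_ge0 (le_trans dS) // ler_nat.
(* [ball_sum_ge0] ranges over all of [hist K n], so the weight is extended by 0 outside [Hn]. *)
pose a h := if h \in Hn K n then P h * W g h else 0.
have gS x : (S <= g x)%N /\ (g x + S <= n)%N.
  have low y : (S <= g y)%N.
    rewrite -(ler_nat R); apply: le_trans (Hn1 y) _.
    by have := gx y; rewrite ler_norml; lra.
  (* A second bin already holds at least [S] of the [n] records, which bounds [g x] away from
     [n]. *)
  split=> //; have [y yx] : exists y : 'I_K, y != x by exact: other.
  move: gn; rewrite inE => /eqP sg.
  suff : (g x + S <= \sum_i g i)%N by rewrite sg.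
  rewrite (bigD1 x) //= leq_add2l.
  by rewrite (bigD1 y) //= (leq_trans (low y)) // leq_addr.
have a0 h : 0 <= a h by rewrite /a; case: ifP => // hn; exact: W0.
have amono h x y : balanced g h -> (excess h g < S)%N -> outward g h x y ->
    t * a h <= a (transfer x y h).
  move=> bal hS O; have hn : h \in Hn K n by rewrite (Hn_balanced _ gn).
  case/and3P: (O) => xy gxh hyg; have cl := close h hn (ltnW hS).
  have [gSx1 gSx2] := gS x; have [gSy1 gSy2] := gS y.
  have [hx _] := excess_interior bal hS gSx1 gSx2.
  have [_ hy] := excess_interior bal hS gSy1 gSy2.
  have hn' := transfer_Hn xy hx hy hn.
  rewrite /a hn hn'.
  have dp : theta * W g h <= W g (transfer x y h).
    exact: (dpW hn hn' gn (neighbor_transfer xy hx hy)).1.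
  have Pt := multinom_pmf_transfer p xy hx hy.
  suff PP : t * P h <= theta * P (transfer x y h).
    rewrite mulrA; apply: le_trans (ler_wpM2r ((hsmW hn).1 _ gn) PP) _.
    by rewrite mulrAC mulrC ler_wpM2l // ?(ltW (P0 _)) // mulrC.
  have c0 : 0 < (h x).+1%:R * p y :> R by rewrite mulr_gt0.
  rewrite -(ler_pM2l c0).
  have -> : (h x).+1%:R * p y * (theta * P (transfer x y h))
      = theta * (h y)%:R * p x * P h.
    transitivity (theta * ((h x).+1%:R * p y * P (transfer x y h))); first by ring.
    by rewrite [X in theta * X]Pt /P; ring.
  rewrite mulrA ler_wpM2r ?(ltW (P0 _)) //.
  have n0 : 0 <= n%:R :> R by [].
  have {}Hn2 : S%:R + 1 <= eta * n%:R / 2 by rewrite natr1.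
  have px0 := p0 x; have py0 := p0 y.
  (* From [g] to [h] a coordinate moves by at most [S], so [h x + 1] is at most
     [(p x + eta) n + S + 1], below [(p x + 2 eta) n]; [h y] is bounded below in the same way. *)
  apply: (@le_trans _ _ (t * p y * (p x + 2 * eta) * n%:R)).
    have -> : (h x).+1%:R * p y * t = t * p y * (h x).+1%:R by ring.
    rewrite -[X in _ <= X]mulrA ler_wpM2l ?(mulr_ge0 (ltW _) (ltW _)) //.
    have := gx x; have := cl x; rewrite !ler_norml -[(h x).+1%:R]natr1.
    have : 0 <= S%:R :> R by [].
    lra.
  apply: (@le_trans _ _ (theta * p x * (p y - 2 * eta) * n%:R)).
    by rewrite ler_wpM2r.
  have -> : theta * (h y)%:R * p x = theta * p x * (h y)%:R by ring.
  rewrite -mulrA ler_wpM2l ?(mulr_ge0 (ltW _) (ltW _)) //.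
  have := gx y; have := cl y; rewrite !ler_norml.
  have : 0 <= S%:R :> R by [].
  lra.
have := @ball_sum_ge0 R k t t1 n S g a gS a0 amono.
rewrite -/delta; congr (0 <= _); apply: eq_big => h.
  by rewrite (Hn_balanced _ gn).
by move=> /andP[bal _]; rewrite /a (Hn_balanced _ gn) bal.
Qed.

End LowerBound.

Lemma limit_mean_continuous (R : realType) k (x : R) : 0 < x < 1 ->
  {for x, continuous (limit_mean k)}.
Proof.
move=> x01; have S0 := Spoly_gt0 k x01.
have x1 : 1 - x != 0 by rewrite gt_eqF // subr_gt0; case/andP: x01.
apply: cvgM; first exact: cvg_id.
apply: cvgD; apply: cvgM; try exact: cvg_cst.
- by apply: cvgV => //; apply: cvgB; [exact: cvg_cst | exact: cvg_id].
- exact: continuous_horner.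
- by apply: cvgV; [rewrite gt_eqF | exact: continuous_horner].
Qed.

(** The gain [a b (1 - tau)] is at least [5 eta], while the loss [2 eta (a + tau b)] is at most
    [4 eta]. *)
Lemma multinomial_ratio_bound (R : realFieldType) (theta tau a b q eta : R) :
  0 < theta -> 0 < tau < 1 -> 0 < q -> q <= a <= 1 -> q <= b <= 1 ->
  eta = (1 - tau) * q ^+ 2 / 5 ->
  (tau * theta) * b * (a + 2 * eta) <= theta * a * (b - 2 * eta).
Proof.
move=> th0 /andP[tau0 tau1] q0 /andP[qa a1] /andP[qb b1] etaE.
have eta0 : 0 <= eta.
  by rewrite etaE divr_ge0 // mulr_ge0 ?sqr_ge0 // subr_ge0 ltW.
rewrite -subr_ge0.
have -> : theta * a * (b - 2 * eta) - tau * theta * b * (a + 2 * eta)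
   = theta * (a * b * (1 - tau) - 2 * eta * (a + tau * b)) by ring.
rewrite mulr_ge0 ?(ltW th0) // subr_ge0.
have H1 : 5 * eta <= a * b * (1 - tau).
  rewrite etaE mulrC divfK // mulrC ler_wpM2r ?subr_ge0 ?(ltW tau1) // expr2.
  by apply: ler_pM => //; apply: ltW.
have H2 : eta * (a + tau * b) <= eta * 2.
  rewrite ler_wpM2l //; have : tau * b <= 1.
    by rewrite mulr_ile1 ?(ltW tau0) ?(ltW tau1) // (le_trans _ qb) // ltW.
  lra.
lra.
Qed.

(** Error budget before doubling: [eps / 8] for replacing [theta] by [t], [eps / 8] for the radius
    [S], and [eps / 4] for atypical inputs. *)
Lemma Dn_asymptotic_ge (R : realType) k (p : 'I_k.+1 -> R) (theta eps : R) :
  (0 < k)%N -> (forall x, 0 < p x) -> \sum_x p x = 1 -> 0 < theta < 1 -> 0 < eps ->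
  \forall n \near \oo, forall W : mech R k.+1 n, isHSM W -> isDP theta W ->
    2 * limit_mean k theta - eps <= Dn W p.
Proof.
move=> k0 p0 p1 th01 eps0; have /andP[th0 th1] := th01.
have other (x : 'I_k.+1) : exists y, y != x.
  case: (eqVneq ord0 x) => [<-|x0]; last by exists ord0.
  by exists (Ordinal (k0 : (1 < k.+1)%N)).
have [t [t0 tth Ht]] : exists t, [/\ 0 < t, t < theta
    & limit_mean k theta - eps / 8 < limit_mean k t].
  have C : limit_mean k z @[z --> theta^'-] --> limit_mean k theta :=
    cvg_at_left_filter (limit_mean_continuous (k := k) th01).
  have := cvgr_gt _ C (limit_mean k theta - eps / 8).
  rewrite ltrBlDr ltrDl divr_gt0 // => /(_ _ isT) N1.
  near theta^'- => t; exists t; split; near: t.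
  - exact: nbhs_left_gt.
  - exact: nbhs_left_lt.
  - exact: N1.
have t01 : 0 < t < 1 by rewrite t0 (lt_trans tth).
have [S HS] : exists S, limit_mean k t - eps / 8 < ball_mean k t S.
  have := cvgr_gt _ (ball_mean_cvg (k := k) t01) (limit_mean k t - eps / 8).
  rewrite ltrBlDr ltrDl divr_gt0 // => /(_ _ isT) N1.
  by near \oo => S; exists S; near: S; exact: N1.
pose q := \prod_x p x; have q0 : 0 < q by apply: prodr_gt0.
have ple1 x := prob_le1 p0 p1 x.
have qle x : q <= p x := prod_prob_le p0 p1 x.
pose tau := t / theta.
have tau01 : 0 < tau < 1 by rewrite divr_gt0 // ltr_pdivrMr // mul1r.
pose eta := (1 - tau) * q ^+ 2 / 5.
have eta0 : 0 < eta.
  by rewrite divr_gt0 // mulr_gt0 ?exprn_gt0 // subr_gt0; case/andP: tau01.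
have etaq : 5 * eta <= q.
  rewrite /eta mulrC divfK // expr2 mulrA ler_piMl ?(ltW q0) //.
  rewrite mulr_ile1 ?(ltW q0) //.
  - by rewrite subr_ge0 ltW //; case/andP: tau01.
  - by rewrite gerBl ltW //; case/andP: tau01.
  - exact: le_trans (qle ord0) (ple1 _).
near=> n => W hsmW dpW.
have n1 : S.+1%:R * 2 / eta <= n%:R by near: n; exact: nbhs_infty_ger.
(* Chosen so that [S] times the deviation bound, [4 K S / (eta ^ 2 n)], is at most [eps / 4]. *)
have n2 : 16 * k.+1%:R * S%:R / (eta ^+ 2 * eps) <= n%:R by near: n; exact: nbhs_infty_ger.
have n0 : 0 < n%:R :> R by apply: lt_le_trans n1; rewrite divr_gt0.
have Hn2 : S.+1%:R <= eta * n%:R / 2.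
  by move: n1; rewrite ler_pdivrMr // ler_pdivlMr // [eta * _]mulrC.
have Hn1 x : S%:R <= (p x - eta) * n%:R.
  have A : (4 * eta) * n%:R <= (p x - eta) * n%:R.
    by rewrite ler_wpM2r ?(ltW n0) //; have := qle x; lra.
  have B : S%:R <= S.+1%:R :> R by rewrite ler_nat.
  have D : 0 < eta * n%:R by rewrite mulr_gt0.
  lra.
have Heta x y : t * p y * (p x + 2 * eta) <= theta * p x * (p y - 2 * eta).
  have -> : t = tau * theta by rewrite /tau divfK // gt_eqF.
  by apply: (@multinomial_ratio_bound _ _ _ _ _ q) => //; rewrite qle ple1.
have := Dn_ge_ball_mean p0 p1 other t0 tth th1 hsmW dpW Heta Hn1 Hn2.
apply: le_trans.
have r0 : 0 < eta * n%:R / 2 by rewrite divr_gt0 // mulr_gt0.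
have Dv := multinom_pmf_deviates p0 p1 n r0.
have : S%:R * \sum_(h in Hn k.+1 n | deviates p (eta * n%:R / 2) h) multinom_pmf p h <= eps / 4.
  apply: le_trans (ler_wpM2l _ Dv) _; first by [].
  have -> : S%:R * (k.+1%:R * (n%:R / (eta * n%:R / 2) ^+ 2))
     = (16 * k.+1%:R * S%:R / (eta ^+ 2 * eps)) / n%:R * (eps / 4).
    by field; rewrite !gt_eqF.
  by rewrite ler_piMl ?divr_ge0 ?(ltW eps0) // ler_pdivrMr // mul1r.
lra.
Unshelve. all: by end_near. Qed.

(** * The truncated geometric mechanism *)

Lemma sum_int_parts K (x : 'I_K -> int) :
  \sum_i x i = (\sum_i `|Num.max (x i) 0|)%N%:Z - (\sum_i `|Num.max (- x i) 0|)%N%:Z /\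
  (\sum_i `|x i| = \sum_i `|Num.max (x i) 0| + \sum_i `|Num.max (- x i) 0|)%N.
Proof.
have P (z : int) : z = `|Num.max z 0|%N%:Z - `|Num.max (- z) 0|%N%:Z by lia.
split; last by rewrite -big_split; apply: eq_bigr => i _ /=; lia.
rewrite !(big_morph Posz PoszD (erefl _)) -sumrB; apply: eq_bigr => i _.
exact: P.
Qed.

(** The positive and negative parts have the same mass [d], so the norm is even and no coordinate
    exceeds half of it. *)
Lemma l1_zero_sum K (x : 'I_K -> int) : \sum_i x i = 0 ->
  exists d, (\sum_i `|x i|)%N = d.*2 /\ forall i, (`|x i| <= d)%N.
Proof.
have [-> E2] := sum_int_parts x; rewrite E2.
move=> E; exists (\sum_i `|Num.max (x i) 0|)%N.
have {}E : (\sum_i `|Num.max (x i) 0| = \sum_i `|Num.max (- x i) 0|)%N.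
  by apply/eqP; rewrite -eqz_nat -subr_eq0 E.
split; first by rewrite -E addnn.
move=> i; have A : (`|Num.max (x i) 0| <= \sum_i `|Num.max (x i) 0|)%N.
  by rewrite (bigD1 i) //= leq_addr.
have B : (`|Num.max (- x i)%R 0%R| <= \sum_i `|Num.max (x i) 0|)%N.
  by rewrite E (bigD1 i) //= leq_addr.
by move: A B; move: (\sum_(i < K) _)%N => s; lia.
Qed.

Lemma zsum_l1z K n (b : zvec K) (h : hist K n) : zsum b = n%:Z -> h \in Hn K n ->
  exists d, l1z (fun x => b x) (hz h) = d.*2 /\ forall x, (`|b x - hz h x| <= d)%N.
Proof.
rewrite inE => bn /eqP hn; apply: l1_zero_sum.
have hs : \sum_x hz h x = n%:Z.
  by have := congr1 Posz hn; rewrite (big_morph Posz PoszD (erefl _)).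
by rewrite sumrB hs -bn subrr.
Qed.

Section ShellSums.
Variables (R : realType) (K n : nat) (h : hist K n).
Hypothesis hn : h \in Hn K n.

Definition zshell d := [set b : zvec K | zsum b = n%:Z /\ l1z (fun x => b x) (hz h) = d.*2].

(** The shell around [h] in the integer lattice may leave the simplex. It is translated to the shell
    around a constant histogram in a box of side [2 d], where [card_shell] applies. *)
Let center d : hist K d.*2 := [ffun => inord d].

Let centerE d x : center d x = d :> nat.
Proof. by rewrite ffunE inordK //; lia. Qed.

Let embed d (y : hist K d.*2) : zvec K := [ffun x => hz h x + ((y x)%:Z - d%:Z)].

Let hsum : \sum_x hz h x = n%:Z.
Proof.
move: hn; rewrite inE => /eqP /(congr1 Posz).
by rewrite (big_morph Posz PoszD (erefl _)).
Qed.

Let embed_shell d : set_bij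
  [set y : hist K d.*2 | (excess y (center d) == d) && (excess (center d) y == d)]
  (zshell d) (@embed d).
Proof.
have E (y : hist K d.*2) : zsum (embed y) =
    n%:Z + ((excess y (center d))%:Z - (excess (center d) y)%:Z).
  rewrite -(excess_int y (center d)).1 -hsum -big_split; apply: eq_bigr => x _.
  by rewrite ffunE centerE.
have F (y : hist K d.*2) : l1z (fun x => embed y x) (hz h) =
    (excess y (center d) + excess (center d) y)%N.
  rewrite -(excess_int y (center d)).2; apply: eq_bigr => x _.
  by rewrite ffunE centerE addrAC subrr add0r.
split.
- move=> y /= /andP[/eqP yd /eqP dy]; rewrite /zshell /= E F yd dy addnn.
  by rewrite subrr addr0.
- move=> y y' _ _ /ffunP e; apply/ffunP => x; apply: val_inj => /=.
  by have := e x; rewrite !ffunE; lia.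
- move=> b [bn bd].
  have [d' [dd' cl]] := zsum_l1z bn hn.
  have {dd'} dd' : d' = d by move: dd'; rewrite bd; lia.
  rewrite {d'}dd' in cl.
  pose y : hist K d.*2 := [ffun x => inord `|(b x - hz h x + d%:Z)%R|%N].
  have yE x : (y x)%:Z = b x - hz h x + d%:Z.
    by rewrite ffunE inordK; have := cl x; lia.
  have ey : embed y = b.
    by apply/ffunP => x; rewrite ffunE yE; ring.
  exists y => //=.
  have := E y; have := F y; rewrite ey bn bd => F' E'.
  have {}E' : excess y (center d) = excess (center d) y.
    by move: E'; move: (excess _ _) (excess _ _) => a c; lia.
  by move: F'; rewrite E'; move: (excess _ _) => a; rewrite addnn => /double_inj ->; rewrite eqxx.
Qed.

Lemma esum_zshell d (c : R) : 0 <= c ->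
  \esum_(b in zshell d) c%:E = ((shell_size K d)%:R * c)%:E.
Proof.
move=> c0; rewrite (@reindex_esum R _ _ _ _ _ _ (embed_shell d)).
pose S := [set y : hist K d.*2 | (excess y (center d) == d) && (excess (center d) y == d)]%SET.
rewrite (_ : [set y | _] = [set` enum S]); last first.
  by apply/seteqP; split => y /=; rewrite mem_enum inE.
rewrite esum_fset; [|exact: finite_seq|by move=> *; rewrite lee_fin].
rewrite -fsbig_seq ?enum_uniq // big_enum /= sumEFin sumr_const mulr_natl.
by rewrite card_shell // => x; rewrite centerE; lia.
Qed.

Lemma esum_zvec (F : nat -> R) (l : R) : (forall d, 0 <= F d) ->
  series (fun d => (shell_size K d)%:R * F d) m @[m --> \oo] --> l ->
  \esum_(b in [set b : zvec K | zsum b = n%:Z]) (F (l1z (fun x => b x) (hz h))./2)%:E = l%:E.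
Proof.
move=> F0 Fl.
have -> : [set b : zvec K | zsum b = n%:Z] = \bigcup_(d in setT) zshell d.
  apply/seteqP; split => [b /= bn|b [d _ [bn _]] //].
  by have [d [bd _]] := zsum_l1z bn hn; exists d.
rewrite esum_bigcupT //; last first.
- by move=> b; rewrite lee_fin.
- apply/trivIsetP => i j _ _ ij; rewrite -subset0 => b [[_ bi] [_ bj]].
  by move: ij; rewrite -(double_inj (etrans (esym bi) bj)) eqxx.
rewrite (eq_esum (b := fun d => ((shell_size K d)%:R * F d)%:E)); last first.
  move=> d _; rewrite -esum_zshell //; apply: eq_esum => b [_ bd] /=; rewrite bd.
  by rewrite doubleK.
rewrite -nneseries_esumT; last by move=> d; rewrite lee_fin mulr_ge0.
apply/cvg_lim => //; under eq_fun do rewrite sumEFin.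
by apply: cvg_EFin; [exact: nearW | exact: Fl].
Qed.

End ShellSums.

Lemma esum_scale_le (R : realType) (T : choiceType) (A : set T) (u : T -> R) (c : R) :
  0 <= c -> (forall x, 0 <= u x) ->
  (c%:E * (\esum_(x in A) (u x)%:E) <= \esum_(x in A) (c * u x)%:E)%E.
Proof.
move=> c0 u0; have [->|cN0] := eqVneq c 0.
  by rewrite mul0e esum_ge0 // => x _; rewrite mul0r lee_fin.
have cp : 0 < c by rewrite lt_neqAle eq_sym cN0.
rewrite muleC -lee_pdivlMr //; apply: ge_ereal_sup => _ [X XA <-].
rewrite lee_pdivlMr //; apply: esum_ge; exists X => //.
have Xfin : finite_set X := XA.1.
rewrite !fsbig_finite //= !sumEFin -EFinM lee_fin mulr_suml.
by apply: ler_sum => x _; rewrite mulrC.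
Qed.

Lemma cvg_series_tail (R : realType) (v : R ^nat) (M : nat) (l : R) :
  series v n @[n --> \oo] --> l ->
  series (fun d => if (M <= d)%N then v d else 0) n @[n --> \oo] --> l - series v M.
Proof.
move=> vl; have : (series v n - series v M) @[n --> \oo] --> l - series v M.
  by apply: cvgB => //; exact: cvg_cst.
apply: cvg_trans; apply: near_eq_cvg; near=> n.
have Mn : (M <= n)%N by near: n; exists M.
rewrite /series /= (big_cat_nat (n := M) (p := n)) //= [in RHS](big_cat_nat (n := M) (p := n)) //=.
rewrite addrAC subrr add0r big_nat_cond [RHS]addrC.
rewrite [X in _ = _ + X]big_nat_cond [X in _ = _ + X]big1 ?addr0; last first.
  by move=> i /andP[/andP[_ iM] _]; rewrite leqNgt iM.
by rewrite [RHS]big_nat_cond; apply: eq_bigr => i /andP[/andP[-> _] _].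
Unshelve. all: by end_near. Qed.

Lemma l1z_triangle K (x y z : 'I_K -> int) : (l1z x z <= l1z x y + l1z y z)%N.
Proof. by rewrite /l1z -big_split; apply: leq_sum => i _ /=; lia. Qed.

Lemma l1zC K (x y : 'I_K -> int) : l1z x y = l1z y x.
Proof. by apply: eq_bigr => i _; lia. Qed.

Section Truncation.
Variables (R : realType) (k : nat) (theta : R).
Hypotheses (k0 : (0 < k)%N) (th01 : 0 < theta < 1).
Local Notation K := k.+1.

Let th0 : 0 < theta. Proof. by case/andP: th01. Qed.
Let th01' : 0 <= theta < 1. Proof. by rewrite ltW //=; case/andP: th01. Qed.
Let y0 : 0 < 1 - theta. Proof. by rewrite subr_gt0; case/andP: th01. Qed.

Let dist n (b : zvec K) (h : hist K n) := l1z (fun x => b x) (hz h).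

Let Z := (1 - theta) * Ehr K theta.

Let ZE : Z = (Spoly R K).[theta] / (1 - theta) ^+ k.
Proof.
rewrite /Z Ehr_closed_form // exprS; field.
by rewrite expf_neq0 ?gt_eqF.
Qed.

Let Z0 : 0 < Z.
Proof. by rewrite ZE divr_gt0 ?exprn_gt0 // Spoly_gt0. Qed.

Let mass_cvg : series (fun d => (shell_size K d)%:R * theta ^+ d) n @[n --> \oo] --> Z.
Proof.
have -> : (fun d => (shell_size K d)%:R * theta ^+ d)
    = (fun d => (sqbin_coef k k.-1 d)%:R * theta ^+ d).
  by apply/funext => d; rewrite shell_sizeE.
by have := @sqbin_coef_cvg R theta th01' k k.-1; rewrite prednK // ZE.
Qed.

Let moment d : R := (shell_size K d)%:R * (Z^-1 * (d%:R * theta ^+ d)).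

Let moment_cvg : series moment n @[n --> \oo] --> limit_mean k theta.
Proof.
have -> : series moment = (fun n =>
    Z^-1 * series (fun d => d%:R * ((sqbin_coef k k.-1 d)%:R * theta ^+ d)) n).
  apply/funext => n; rewrite /series /= mulr_sumr; apply: eq_bigr => d _.
  by rewrite /moment shell_sizeE //; ring.
have -> : limit_mean k theta = Z^-1 * (theta * (Spoly R K)^`().[theta] / (1 - theta) ^+ k
    + k%:R * theta * (Spoly R K).[theta] / (1 - theta) ^+ k.+1).
  rewrite ZE /limit_mean exprS; have : (1 - theta) ^+ k != 0 by rewrite expf_neq0 ?gt_eqF.
  move: (_ ^+ k) => P P0; field.
  by rewrite P0 !gt_eqF ?Spoly_gt0.
apply: cvgMl_tmp.
by have := @sqbin_coef_moment_cvg R theta th01' k k.-1; rewrite prednK.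
Qed.

Let moment_ge0 d : 0 <= moment d.
Proof. by rewrite /moment !mulr_ge0 ?invr_ge0 ?exprn_ge0 // ltW. Qed.

Section FixedSize.
Variable n : nat.

(** A default element, needed to take a minimum over [Hn]. *)
Definition corner : hist K n := [ffun i => if i == ord0 then ord_max else ord0].

Lemma corner_Hn : corner \in Hn K n.
Proof.
rewrite inE (bigD1 ord0) //= ffunE eqxx big1 ?addn0 // => i i0.
by rewrite ffunE (negPf i0).
Qed.

Definition nearest (b : zvec K) : hist K n :=
  [arg min_(g < corner in Hn K n) l1z (fun x => b x) (hz g)].

Lemma nearest_Hn b : nearest b \in Hn K n.
Proof. by rewrite /nearest; case: arg_minnP => //; exact: corner_Hn. Qed.

Lemma nearest_le b g : g \in Hn K n -> (dist b (nearest b) <= dist b g)%N.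
Proof.
rewrite /nearest; case: arg_minnP => [|i _ H]; first exact: corner_Hn.
exact: H.
Qed.

Let U (b : zvec K) (h : hist K n) : R := Ugeo theta b h.

Let U0 b h : 0 <= U b h.
Proof. by rewrite /U /Ugeo mulr_ge0 ?invr_ge0 ?exprn_ge0 // ltW. Qed.

Let zv := [set b : zvec K | zsum b = n%:Z].

Let fiber g := [set b : zvec K | zsum b = n%:Z /\ nearest b = g].

Let W := Wtrunc theta nearest.

Let sum_fiber (V : zvec K -> R) : (forall b, 0 <= V b) ->
  (\sum_(g in Hn K n) \esum_(b in fiber g) (V b)%:E = \esum_(b in zv) (V b)%:E)%E.
Proof.
move=> V0.
have fE g : fiber g = zv `&` [set b | nearest b = g] by [].
under eq_bigr => g _ do rewrite fE esum_mkcondr.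
rewrite -esum_sum; last by move=> b g _ _; case: ifP; rewrite ?lee_fin.
apply: eq_esum => b _; rewrite (bigD1 (nearest b)) ?nearest_Hn //=.
rewrite mem_set // big1 ?adde0 // => g /andP[_ gb].
by rewrite memNset // => /= E; rewrite E eqxx in gb.
Qed.

Let esum_U h : h \in Hn K n -> \esum_(b in zv) (U b h)%:E = 1%E.
Proof.
move=> hn; apply: (@esum_zvec R K n h hn (fun d => Z^-1 * theta ^+ d) 1).
  by move=> d; rewrite mulr_ge0 ?invr_ge0 ?exprn_ge0 // ltW.
have -> : series (fun d => (shell_size K d)%:R * (Z^-1 * theta ^+ d)) =
  (fun n => Z^-1 * series (fun d => (shell_size K d)%:R * theta ^+ d) n).
  apply/funext => m; rewrite /series /= mulr_sumr.
  by apply: eq_bigr => d _; rewrite mulrCA.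
have : Z^-1 * series (fun d => (shell_size K d)%:R * theta ^+ d) m @[m --> \oo] --> Z^-1 * Z.
  exact: cvgMl_tmp.
by rewrite mulVf // gt_eqF.
Qed.

Let W_esum g h : h \in Hn K n -> (W g h)%:E = \esum_(b in fiber g) (U b h)%:E.
Proof.
move=> hn; rewrite fineK // ge0_fin_numE.
  apply: (@le_lt_trans _ _ 1%E); last by rewrite ltry.
  rewrite -(esum_U hn) (esumID [set b | nearest b = g] zv); last by move=> *; rewrite lee_fin.
  by rewrite leeDl // esum_ge0 // => *; rewrite lee_fin.
by apply: esum_ge0 => b _; rewrite lee_fin.
Qed.

Lemma Wtrunc_HSM : isHSM W.
Proof.
move=> h hn; split => [g gn|].
  by rewrite -lee_fin W_esum // esum_ge0 // => b _; rewrite lee_fin.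
apply: EFin_inj; rewrite -sumEFin -(esum_U hn) -sum_fiber //.
by apply: eq_bigr => g _; exact: W_esum.
Qed.

(** Passing to a neighbor changes half the distance to any [b] by at most 1, hence costs at most a
    factor [theta]; summing over a fibre of [nearest] preserves this. *)
Let W_neighbor h h' g : h \in Hn K n -> h' \in Hn K n -> (l1z (hz h) (hz h') <= 2)%N ->
  theta * W g h <= W g h'.
Proof.
move=> hn hn' hh'; rewrite -lee_fin EFinM !W_esum //.
apply: le_trans (esum_scale_le _ (ltW th0) _) _ => //.
apply: le_esum => b _; rewrite lee_fin /U /Ugeo mulrCA ler_wpM2l ?invr_ge0 ?(ltW Z0) //.
rewrite -exprS; apply: ler_wiXn2l; rewrite ?(ltW th0) //; first by case/andP: th01 => _ /ltW.
have := l1z_triangle (fun x => b x) (hz h) (hz h').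
move=> /leq_trans/(_ (leq_add (leqnn _) hh')).
by move: (l1z _ (hz h)) (l1z _ (hz h')) => x y; lia.
Qed.

Lemma Wtrunc_DP : isDP theta W.
Proof.
move=> h h' g hn hn' gn nb; split; first by apply: W_neighbor => //; rewrite nb.
rewrite mulrC ler_pdivlMr // mulrC; apply: W_neighbor => //.
by rewrite l1zC nb.
Qed.

Let nearest_dist (b : zvec K) (h : hist K n) M : zsum b = n%:Z -> h \in Hn K n ->
  (forall x, (M <= h x)%N) ->
  (l1z (hz h) (hz (nearest b)) <=
    2 * (dist b h)./2 + (if (M <= (dist b h)./2)%N then 2 * (dist b h)./2 else 0))%N.
Proof.
move=> bn hn Mh; have [d [bd cl]] := zsum_l1z bn hn.
have D : dist b h = d.*2 by [].
have T := l1z_triangle (hz h) (fun x => b x) (hz (nearest b)).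
rewrite [l1z (hz h) (fun x => b x)]l1zC -/(dist b h) -/(dist b (nearest b)) in T.
rewrite D doubleK; apply: leq_trans T _; rewrite D.
case: ifP => Md; first by have := nearest_le b hn; rewrite D; lia.
(* Here [|b x - h x| <= d < M <= h x], so [b] is itself a histogram and rounding leaves it fixed. *)
have bpos x : 0 <= b x by have := cl x; have := Mh x; rewrite /hz; lia.
have bE x : b x = `|b x|%N%:Z by have := bpos x; lia.
have sb : (\sum_x `|b x| = n)%N.
  apply/eqP; rewrite -eqz_nat -bn (big_morph Posz PoszD (erefl _)).
  by apply/eqP; apply: eq_bigr => x _; rewrite -bE.
have ble x : (`|b x| < n.+1)%N by rewrite ltnS -sb (bigD1 x) //= leq_addr.
pose g : hist K n := [ffun x => inord `|b x|%N].
have gE x : g x = `|b x|%N :> nat by rewrite ffunE inordK.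
have gn : g \in Hn K n.
  by rewrite inE -[X in _ == X]sb; apply/eqP; apply: eq_bigr => x _; rewrite gE.
have := nearest_le b gn.
rewrite {2}/dist /l1z big1 => [|x _]; last by rewrite /hz gE -bE subrr.
by rewrite leqn0 => /eqP->; lia.
Qed.

(** The last term pays for rounding, which can matter only when the noise has half-norm at least
    [M], the distance of [h] from the boundary. *)
Lemma Wtrunc_distortion h M : h \in Hn K n -> (forall x, (M <= h x)%N) ->
  \sum_(g in Hn K n) W g h * (l1z (hz h) (hz g))%:R
  <= 2 * limit_mean k theta + 2 * (limit_mean k theta - series moment M).
Proof.
move=> hn Mh.
pose F d : R := Z^-1 * theta ^+ d * (2 * d%:R + (if (M <= d)%N then 2 * d%:R else 0)).
have F0 d : 0 <= F d.
  rewrite /F !mulr_ge0 ?invr_ge0 ?exprn_ge0 ?(ltW th0) ?(ltW Z0) //.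
  by case: ifP => _; rewrite ?addr0 ?addr_ge0 // mulr_ge0.
have Fl : series (fun d => (shell_size K d)%:R * F d) m @[m --> \oo] -->
    2 * limit_mean k theta + 2 * (limit_mean k theta - series moment M).
  have -> : series (fun d => (shell_size K d)%:R * F d) = (fun m => 2 * series moment m
     + 2 * series (fun d => if (M <= d)%N then moment d else 0) m).
    apply/funext => m; rewrite /series /= !mulr_sumr -big_split; apply: eq_bigr => d _.
    by rewrite /F /moment /=; case: ifP => _; ring.
  by apply: cvgD; apply: cvgMl_tmp => //; exact: cvg_series_tail.
rewrite -lee_fin -(esum_zvec hn F0 Fl) -sumEFin.
pose V b : R := (l1z (hz h) (hz (nearest b)))%:R * U b h.
have V0 b : 0 <= V b by rewrite /V mulr_ge0.
apply: (@le_trans _ _ (\esum_(b in zv) (V b)%:E)); last first.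
  apply: le_esum => b bn; rewrite lee_fin /V /U /Ugeo -/Z mulrC /F -/(dist b h).
  rewrite ler_wpM2l ?mulr_ge0 ?invr_ge0 ?exprn_ge0 ?(ltW th0) ?(ltW Z0) //.
  have := nearest_dist bn hn Mh; rewrite -(ler_nat R) natrD.
  by case: ifP => _; rewrite !natrM.
rewrite -sum_fiber //; apply: lee_sum => g _; rewrite mulrC EFinM W_esum //.
apply: le_trans (esum_scale_le _ _ _) _ => //.
by rewrite le_eqVlt; apply/orP; left; apply/eqP/eq_esum => b [_ <-].
Qed.

End FixedSize.

Lemma Wtrunc_asymptotic_le (p : 'I_K -> R) (eps : R) :
  (forall x, 0 < p x) -> \sum_x p x = 1 -> 0 < eps ->
  \forall n \near \oo, Dn (Wtrunc theta (@nearest n)) p <= 2 * limit_mean k theta + eps.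
Proof.
move=> p0 p1 eps0; set lm := limit_mean k theta.
have lm0 : 0 <= lm.
  have -> : lm = limn (series moment) by rewrite (cvg_lim _ moment_cvg).
  apply: limr_ge; first exact: (cvgP _ moment_cvg).
  by apply: nearW => n; apply: sumr_ge0 => d _.
have [M HM] : exists M, lm - eps / 4 < series moment M.
  have := cvgr_gt _ moment_cvg (lm - eps / 4).
  rewrite ltrBlDr ltrDl divr_gt0 // => /(_ _ isT) N1.
  by near \oo => M; exists M; near: M; exact: N1.
pose q := \prod_x p x; have q0 : 0 < q by apply: prodr_gt0.
have qle x : q <= p x := prod_prob_le p0 p1 x.
near=> n.
have n1 : M%:R * 2 / q + 1 <= n%:R by near: n; exact: nbhs_infty_ger.
(* Makes [2 * lm] times the deviation bound, [4 K / (q ^ 2 n)], at most [eps / 4]. *)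
have n2 : 16 * K%:R * (2 * lm) / (q ^+ 2 * eps) <= n%:R by near: n; exact: nbhs_infty_ger.
have n0 : 0 < n%:R :> R.
  by apply: lt_le_trans n1; rewrite ltr_wpDl // divr_ge0 ?(ltW q0) ?mulr_ge0.
have r0 : 0 < q * n%:R / 2 by rewrite divr_gt0 // mulr_gt0.
have Mr : M%:R < q * n%:R / 2.
  have : M%:R * 2 / q < n%:R by apply: lt_le_trans n1; rewrite ltrDl.
  by rewrite ltr_pdivrMr // ltr_pdivlMr // [q * _]mulrC.
(* Each coordinate is at least [p x n - q n / 2 >= q n / 2 > M]. *)
have good (h : hist K n) : ~~ deviates p (q * n%:R / 2) h -> forall x, (M <= h x)%N.
  move=> /existsPn H x; rewrite -(ler_nat R); have := H x; rewrite -leNgt ler_norml.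
  have : q * n%:R <= p x * n%:R by rewrite ler_wpM2r ?(ltW n0).
  lra.
set P := @multinom_pmf R K p n.
have P0 h : 0 < P h by exact: multinom_pmf_gt0.
have -> : Dn (Wtrunc theta (@nearest n)) p = \sum_(h in Hn K n) P h *
    \sum_(g in Hn K n) Wtrunc theta (@nearest n) g h * (l1z (hz h) (hz g))%:R.
  by apply: eq_bigr => h _; rewrite mulr_sumr; apply: eq_bigr => g _; rewrite mulrA.
have bound (h : hist K n) : h \in Hn K n ->
   \sum_(g in Hn K n) Wtrunc theta (@nearest n) g h * (l1z (hz h) (hz g))%:R
    <= (2 * lm + eps / 2) + (if deviates p (q * n%:R / 2) h then 2 * lm else 0).
  move=> hn; case: ifPn => [_|/good Mh].
    (* With [M = 0] the bound is [4 * lm] for every input, which is enough on the atypical ones. *)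
    have := @Wtrunc_distortion n h 0 hn (fun=> leq0n _).
    by rewrite [series moment 0]big_geq // subr0 -/lm; lra.
  by have := Wtrunc_distortion hn Mh; rewrite -/lm; lra.
apply: (@le_trans _ _ (\sum_(h in Hn K n) P h * ((2 * lm + eps / 2)
    + (if deviates p (q * n%:R / 2) h then 2 * lm else 0)))).
  by apply: ler_sum => h hn; rewrite ler_wpM2l ?(ltW (P0 h)) // bound.
under eq_bigr => h _ do rewrite mulrDr.
rewrite big_split /= -mulr_suml sum_multinom_pmf // mul1r -addrA lerD2l.
have -> : \sum_(h in Hn K n) P h * (if deviates p (q * n%:R / 2) h then 2 * lm else 0)
   = 2 * lm * \sum_(h in Hn K n | deviates p (q * n%:R / 2) h) P h.
  rewrite mulr_sumr big_mkcondr; apply: eq_bigr => h _.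
  by case: ifP => _; rewrite ?mulr0 // mulrC.
have Dv := multinom_pmf_deviates p0 p1 n r0.
have : 2 * lm * \sum_(h in Hn K n | deviates p (q * n%:R / 2) h) P h <= eps / 4.
  apply: le_trans (ler_wpM2l _ Dv) _; first by rewrite mulr_ge0.
  have -> : 2 * lm * (K%:R * (n%:R / (q * n%:R / 2) ^+ 2))
     = (16 * K%:R * (2 * lm) / (q ^+ 2 * eps)) / n%:R * (eps / 4).
    by field; rewrite !gt_eqF.
  by rewrite ler_piMl ?divr_ge0 ?(ltW eps0) // ler_pdivrMr // mul1r.
lra.
Unshelve. all: by end_near. Qed.

End Truncation.

(** The optimum is squeezed between the uniform lower bound and the distortion of one admissible
    mechanism, so a single chain of inequalities gives both limits. *)
Lemma Dnstar_cvg (R : realType) k (theta : R) (p : 'I_k.+1 -> R) :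
  (0 < k)%N -> 0 < theta < 1 -> (forall x, 0 < p x) -> \sum_x p x = 1 ->
  Dnstar k.+1 n theta p @[n --> \oo] --> 2 * limit_mean k theta /\
  Dn (Wtrunc theta (@nearest k n)) p @[n --> \oo] --> 2 * limit_mean k theta.
Proof.
move=> k0 th01 p0 p1; set D := 2 * limit_mean k theta.
have near_bounds e : 0 < e -> \forall n \near \oo,
    [/\ D - e <= Dnstar k.+1 n theta p,
        Dnstar k.+1 n theta p <= Dn (Wtrunc theta (@nearest k n)) p
      & Dn (Wtrunc theta (@nearest k n)) p <= D + e].
  move=> e0; near=> n.
  have lower : forall W : mech R k.+1 n, isHSM W -> isDP theta W -> D - e <= Dn W p.
    by near: n; exact: Dn_asymptotic_ge.
  set A := [set x : R | exists W : mech R k.+1 n, [/\ isHSM W, isDP theta W & x = Dn W p]].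
  have AW : A (Dn (Wtrunc theta (@nearest k n)) p).
    by exists (Wtrunc theta (@nearest k n)); split => //;
      [exact: Wtrunc_HSM | exact: Wtrunc_DP].
  have Alb : lbound A (D - e) by move=> _ [W [hsm dp ->]]; exact: lower.
  split.
  - by apply: lb_le_inf => //; exists (Dn (Wtrunc theta (@nearest k n)) p).
  - by apply: ge_inf => //; exists (D - e).
  - by near: n; exact: Wtrunc_asymptotic_le.
split; apply/cvgrPdist_le => e e0; apply: filterS (near_bounds e e0) => n [A B C];
  by rewrite ler_norml; lra.
Unshelve. all: by end_near. Qed.

Unset Implicit Arguments.

Theorem theorem1 (R : realType) (K : nat) (theta : R) (p : 'I_K -> R) :
  (2 <= K)%N -> 0 < theta < 1 ->
  (forall k, 0 < p k) -> \sum_(k < K) p k = 1 ->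
  (* (a) *)
  [/\ derivable (Ehr K) theta 1,
      (fun n => Dnstar K n theta p) @ \oo -->
        2 * theta / Ehr K theta * derive1 (Ehr K) theta - 2 * theta / (1 - theta),
  (* (b) *)
      [/\ cvgn (fun N => \sum_(1 <= d < N) (LP K d)%:R * theta ^+ d),
          cvgn (fun N => \sum_(1 <= d < N) (\sum_(1 <= r < K)
                 ('C(K, r) * 'C(d + r - 1, r - 1) * 'C(d - 1, K - r - 1))%N)%:R
                 * theta ^+ d / (1 - theta))
        & Ehr K theta = 1 / (1 - theta) +
           limn (fun N => \sum_(1 <= d < N) (\sum_(1 <= r < K)
                 ('C(K, r) * 'C(d + r - 1, r - 1) * 'C(d - 1, K - r - 1))%N)%:R
                 * theta ^+ d / (1 - theta))],
  (* (c) *)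
      (fun n => Dnstar K n theta p) @ \oo -->
        2 * theta * ((K.-1)%:R / (1 - theta)
                     + (Spoly R K)^`().[theta] / (Spoly R K).[theta])
  (* moreover *)
    & exists f : forall n : nat, zvec K -> hist K n,
        (forall n b, zsum b = n%:Z -> f n b \in Hn K n) /\
        (forall n, isHSM (Wtrunc theta (f n)) /\ isDP theta (Wtrunc theta (f n))) /\
        (fun n => Dn (Wtrunc theta (f n)) p) @ \oo --> limn (fun n => Dnstar K n theta p)].
Proof.
case: K p => [//|k] p k0 th01 p0 p1; rewrite ltnS in k0.
have th01' : 0 <= theta < 1 by case/andP: th01 => /ltW -> ->.
have [Dstar Dtrunc] := Dnstar_cvg k0 th01 p0 p1.
have shellE : (fun N => \sum_(1 <= d < N) (\sum_(1 <= r < k.+1)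
      ('C(k.+1, r) * 'C(d + r - 1, r - 1) * 'C(d - 1, k.+1 - r - 1))%N)%:R
        * theta ^+ d / (1 - theta)) =
    (fun N => \sum_(1 <= d < N) (shell_size k.+1 d)%:R * theta ^+ d / (1 - theta)).
  apply/funext => N; rewrite big_nat_cond [RHS]big_nat_cond.
  (* [shell_size] agrees with the displayed sum by definition for [d > 0]; the special value at
     [d = 0] lies outside the range. *)
  by apply: eq_bigr => -[|d] //.
have shell := shell_series_cvg k0 th01'.
split.
- by have [] := Ehr_is_derive k0 th01.
- by rewrite Ehr_log_derivative.
- rewrite shellE; split; first exact: cvgP (LP_series_cvg k0 th01').
    exact: cvgP shell.
  by rewrite (cvg_lim _ shell) // Ehr_closed_form // [RHS]addrC subrK.
- rewrite [X in _ --> X](_ : _ = 2 * limit_mean k theta) //.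
  by rewrite /limit_mean mulrA.
- exists (@nearest k); split; [|split].
  + by move=> n b _; exact: nearest_Hn.
  + by move=> n; split; [exact: Wtrunc_HSM | exact: Wtrunc_DP].
  + by rewrite (cvg_lim _ Dstar).
Qed.
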